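(* The algebra map $\mathrm{FQSym}\to\mathrm{QSym}$, $\mathbf{w}\mapsto L_{\alpha(\mathrm{Des}(w))}$, extends (along the embedding $\mathrm{FQSym}\hookrightarrow\mathcal{ASM}$) to an algebra morphism $$\mathcal{ASM}\longrightarrow\mathrm{QSym},\qquad \mathbf{A}\longmapsto L_{\alpha(\mathrm{Des}(A))},$$ where $\mathrm{Des}(A)=\mathrm{Des}(T(A))$ for an alternating sign matrix $A$ is the descent set of its monotone triangle $T(A)$. This map is not a coalgebra morphism.
   Context: Alternating sign matrices and monotone triangles. $[n]=\{1,\ldots,n\}$. $\mathrm{ASM}_n$ is the set of $n\times n$ matrices with entries in $\{0,+1,-1\}$ such that in each row and each column the nonzero entries alternate in sign, beginning and ending with $+1$ (for $n=0$ there is one empty matrix). A set $J=\{j_1<\cdots<j_{m+1}\}$ interlaces $I=\{i_1<\cdots<i_m\}$ if $j_1\le i_1\le j_2\le\cdots\le j_m\le i_m\le j_{m+1}$. A monotone triangle of size $n$ is a sequence $T=(T_0,\ldots,T_n)$ of subsets of $[n]$ with $\#T_m=m$ and $T_{m+1}$ interlacing $T_m$; $\mathrm{MT}_n$ is the set of these. There is a bijection $\mathrm{ASM}_n\to\mathrm{MT}_n$, $A\mapsto T(A)$, where $T(A)_m$ is the subset of $[n]$ whose indicator vector is the sum of the first $m$ rows of $A$. Descents. For $T\in\mathrm{MT}_n$ and $1\le k\le n-1$, with $T_{k-1}=\{a_1<\cdots<a_{k-1}\}$, $T_{k+1}=\{b_1<\cdots<b_{k+1}\}$, let $H_{\min}(T_{k-1},T_{k+1})=\{h_1<\cdots<h_k\}$,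 $h_m=\max(a_{m-1},b_m)$, $a_0:=0$. Then $\mathrm{Des}(T)=\{k\in[n-1]:T_k\ne H_{\min}(T_{k-1},T_{k+1})\}$. For a permutation $w=(w_1,\ldots,w_n)\in\mathfrak{S}_n$, $\mathrm{Des}(w)=\{k\in[n-1]:w_k>w_{k+1}\}$. Quasisymmetric functions. $\mathrm{QSym}\subset\mathbb{Z}[[x_1,x_2,\ldots]]$ is the subalgebra with $\mathbb{Z}$-basis $M_\alpha=\sum_{1\le i_1<\cdots<i_k}x_{i_1}^{\alpha_1}\cdots x_{i_k}^{\alpha_k}$, for compositions $\alpha=(\alpha_1,\ldots,\alpha_k)$, $\alpha_i\ge1$, $k\ge0$. The fundamental quasisymmetric functions are $L_\alpha=\sum_{\beta\text{ refines }\alpha}M_\beta$. The coproduct of $\mathrm{QSym}$ is $\Delta(M_{(\alpha_1,\ldots,\alpha_k)})=\sum_{i=0}^k M_{(\alpha_1,\ldots,\alpha_i)}\otimes M_{(\alpha_{i+1},\ldots,\alpha_k)}$. For $J=\{j_1<\cdots<j_\ell\}\subseteq[n-1]$, $\alpha(J)=(j_1,j_2-j_1,\ldots,j_\ell-j_{\ell-1},n-j_\ell)$, a composition of $n$ (the empty composition if $n=0$). $\mathrm{FQSym}$. The Malvenuto–Reutenauer algebra $\mathrm{FQSym}=\bigoplus_{n\ge0}\mathrm{FQSym}_n$ has $\mathbb{Z}$-basis $\{\mathbf{w}\}_{w\in\mathfrak{S}_n}$ in degree $n$, with product, for $u\in\mathfrak{S}_a$, $v\in\mathfrak{S}_b$,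 $\mathbf{u}\cdot\mathbf{v}=\sum_w\mathbf{w}$ over all shuffles $w\in\mathfrak{S}_{a+b}$ of the sequences $(u_1,\ldots,u_a)$ and $(a+v_1,\ldots,a+v_b)$. $\mathcal{ASM}$. The Cheballah–Giraudo–Maurice Hopf algebra $\mathcal{ASM}=\bigoplus_{n\ge0}\mathcal{ASM}_n$ has $\mathbb{Z}$-basis $\{\mathbf{A}\}_{A\in\mathrm{ASM}_n}$ in degree $n$. Product: for $A\in\mathrm{ASM}_a$, $B\in\mathrm{ASM}_b$, let $A\circ b$ be the $a\times(a+b)$ matrix whose first $a$ columns are $A$ and last $b$ columns are zero, and $a\circ B$ the $b\times(a+b)$ matrix whose first $a$ columns are zero and last $b$ columns are $B$; then $\mathbf{A}\cdot\mathbf{B}=\sum_C\mathbf{C}$, over all $(a+b)\times(a+b)$ matrices $C$ obtained by shuffling the rows of $A\circ b$ with the rows of $a\circ B$ (preserving the order of rows within each). Coproduct: for $A\in\mathrm{ASM}_n$, $\Delta(\mathbf{A})=\sum_i\mathbf{A'_i}\otimes\mathbf{A''_i}$, where $A'_i$ (resp. $A''_i$) is obtained from the first $i$ (resp. last $n-i$) rows of $A$ by deleting all zero columns, and the sum is over those $i\in\{0,1,\ldots,n\}$ for which both $A'_i$ and $A''_i$ are square (in which case both are alternating sign matrices). The embedding $\mathrm{FQSym}\hookrightarrow\mathcal{ASM}$ sends $\mathbf{w}\mapsto\mathbf{A(w)}$, where $A(w)$ is the permutation matrix having its entry $1$ of row $k$ in column $w_k$. *)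

(* Defs.v *)
From HB Require Import structures.
From mathcomp Require Import all_boot all_order all_algebra all_fingroup.
From mathcomp Require Import finmap monalg.

Set Implicit Arguments.
Unset Strict Implicit.
Unset Printing Implicit Defensive.

Import GRing.Theory.
Local Open Scope ring_scope.

(* Free Z-modules: [{malg K}] is the free Z-module on the set [K], with basis
   the elements [<< k >>].  Its ring structure (which needs a monoid structure
   on [K]) is never used: the products below are bilinear maps. *)

Section LinearExtension.
Variables (K : choiceType) (V : zmodType) (f : K -> V).

Definition linext (x : {malg K}) : V := \sum_(k <- msupp x) f k *~ x@_k.

Lemma linextEw (d : {fset K}) x : (msupp x `<=` d)%fset ->
  linext x = \sum_(k <- d) f k *~ x@_k.
Proof.
move=> le; rewrite /linext (big_fset_incl _ le) // => k _ /mcoeff_outdom ->.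
by rewrite mulr0z.
Qed.

Lemma linext_is_zmod_morphism : zmod_morphism linext.
Proof.
move=> x y; pose d := (msupp x `|` msupp y)%fset.
rewrite (linextEw (msuppB_le x y)) (linextEw (fsubsetUl _ _ : _ `<=` d)%fset).
rewrite (linextEw (fsubsetUr _ _ : _ `<=` d)%fset) -sumrB; apply: eq_bigr => k _.
by rewrite mcoeffB mulrzBr.
Qed.

HB.instance Definition _ :=
  GRing.isZmodMorphism.Build {malg K} V linext linext_is_zmod_morphism.

End LinearExtension.

Definition bilinext (K K' : choiceType) (V : zmodType) (f : K -> K' -> V)
    (x : {malg K}) (y : {malg K'}) : V :=
  linext (fun k => linext (f k) y) x.

(* The tensor product of the free modules on [K] and [K'] is the free module
   on [K * K'], with [k (x) k'] the basis element [<< (k, k') >>]. *)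
Definition tensor (K K' : choiceType) : {malg K} -> {malg K'} -> {malg (K * K')%type} :=
  bilinext (fun k k' => << (k, k') >>).

Definition tensor_map (K1 K2 K1' K2' : choiceType)
    (f : {malg K1} -> {malg K1'}) (g : {malg K2} -> {malg K2'}) :
    {malg (K1 * K2)%type} -> {malg (K1' * K2')%type} :=
  linext (fun k => tensor (f << k.1 >>) (g << k.2 >>)).

Definition coalgebra_morphism (K K' : choiceType)
    (coprod : {malg K} -> {malg (K * K)%type}) (counit : {malg K} -> int)
    (coprod' : {malg K'} -> {malg (K' * K')%type}) (counit' : {malg K'} -> int)
    (f : {additive {malg K} -> {malg K'}}) : Prop :=
  (forall x, coprod' (f x) = tensor_map f f (coprod x)) /\
  (forall x, counit' (f x) = counit x).

(* [s] is a shuffle of [t] and [u]: the entries of [s] marked by [m] form [t],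
   the others form [u]. *)
Definition is_shuffle (T : eqType) (t u s : seq T) : bool :=
  [exists m : (size s).-tuple bool,
     (mask m s == t) && (mask (map negb m) s == u)].

(* Subsets of [p] = {1, ..., p} are encoded in {set 'I_p}, the ordinal [i]
   standing for [i.+1]; [elems J] lists the elements in increasing order. *)
Definition elems (p : nat) (J : {set 'I_p}) : seq nat :=
  [seq (val i).+1 | i <- enum J].

Record composition := Composition {
  parts :> seq nat; _ : all (fun a => 0 < a)%N parts }.
HB.instance Definition _ := [isSub for parts].
HB.instance Definition _ := [Choice of composition by <:].

Lemma parts_gt0 (a : composition) : all (fun i => 0 < i)%N a.
Proof. by case: a. Qed.

Fact take_composition_subproof i (a : composition) :
  all (fun i => 0 < i)%N (take i a).
Proof. by apply/allP=> x /mem_take; apply/allP/parts_gt0. Qed.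

Fact drop_composition_subproof i (a : composition) :
  all (fun i => 0 < i)%N (drop i a).
Proof. by apply/allP=> x /mem_drop; apply/allP/parts_gt0. Qed.

Definition take_composition i a := Composition (take_composition_subproof i a).
Definition drop_composition i a := Composition (drop_composition_subproof i a).
Definition empty_composition := @Composition [::] isT.

Definition comp_parts (n : nat) (J : {set 'I_n.-1}) : seq nat :=
  if n is 0 then [::] else pairmap (fun x y => y - x)%N 0%N (rcons (elems J) n).

Fact comp_parts_gt0 n J : all (fun i => 0 < i)%N (@comp_parts n J).
Proof.
case: n J => // n J; rewrite /comp_parts.
have: path ltn 0%N (rcons (elems J) n.+1).
  rewrite rcons_path (path_sortedE ltn_trans) -andbA.
  apply/and3P; split.
  - by apply/allP=> _ /mapP[i _ ->].
  - have := iota_ltn_sorted 0 n; rewrite -val_enum_ord sorted_map => lt_enum.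
    rewrite /elems sorted_map /(enum J) -enumT.
    apply: (@subseq_sorted _ _ _ _ _ (filter_subseq _ _) lt_enum) => i j k.
    by move/ltn_trans; apply.
  - case/lastP E: (elems J) => [//|s x]; rewrite last_rcons /=.
    have: x \in elems J by rewrite E mem_rcons mem_head.
    by case/mapP=> i _ ->; rewrite /= ltnS.
elim: (rcons _ _) {1 3}0%N => //= x s IH y /andP[lt_yx /IH ->].
by rewrite subn_gt0 lt_yx.
Qed.

Definition comp_of_set (n : nat) (J : {set 'I_n.-1}) : composition :=
  Composition (comp_parts_gt0 J).

(* [b] refines [a]: [b] can be cut into consecutive blocks, of lengths [sh],
   whose sums are the parts of [a]. *)
Definition refines (b a : composition) : bool :=
  [exists sh : (size a).-tuple 'I_(size b).+1,
     let s := [seq val i | i <- sh] in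
     (sumn s == size b) && ([seq sumn c | c <- reshape s b] == a :> seq nat)].

(* QSym is the free Z-module on the basis of the M_a, i.e. [<< a >>], sitting
   inside Z[[x_0, x_1, ...]] by means of [series]. *)
Definition QSym := {malg composition}.

Definition power_series := {cmonom nat} -> int.

Definition series_one : power_series := fun m => (m == mone)%:R.

(* The factorizations m = m1 * m2 are indexed by the exponents of m1. *)
Definition series_mul (f g : power_series) : power_series := fun m =>
  \sum_(d : {dffun forall i : finsupp m, 'I_(m (val i)).+1})
    let m1 := [cmonom nat_of_ord (d i) | i : finsupp m]%M in
    f m1 * g (divcm m m1).

(* The nonzero exponents of a monomial, by increasing index of the variable. *)
Definition exponents (m : {cmonom nat}) : seq nat :=
  [seq m i | i <- sort leq (finsupp m)].

(* As the parts of [a] are positive, a monomial [m] is equal to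
   x_{i_1}^{a_1} ... x_{i_k}^{a_k} for at most one i_1 < ... < i_k, and this
   happens iff its list of nonzero exponents is [a]. *)
Definition monomial_series (a : composition) : power_series :=
  fun m => (exponents m == a)%:R.

Definition series (f : QSym) : power_series :=
  fun m => linext (fun a => monomial_series a m) f.

Definition fundamental (a : composition) : QSym :=
  \sum_(J : {set 'I_(sumn a).-1} | refines (comp_of_set J) a)
    << comp_of_set J >>.

Definition QSym_coprod : QSym -> {malg (composition * composition)%type} :=
  linext (fun a : composition => \sum_(i < (size a).+1)
    << (take_composition i a, drop_composition i a) >>).

Definition QSym_counit (f : QSym) : int := f@_empty_composition.

(* The product of QSym is that of Z[[x_0, x_1, ...]]; additive maps between free
   Z-modules are the Z-linear ones. *)
Definition QSym_algebra_morphism (K : choiceType)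
    (mul : {malg K} -> {malg K} -> {malg K}) (one : {malg K})
    (f : {additive {malg K} -> QSym}) : Prop :=
  series (f one) =1 series_one /\
  (forall x y, series (f (mul x y)) =1 series_mul (series (f x)) (series (f y))).

Definition word (n : nat) (w : 'S_n) : seq nat :=
  [seq (val (w i)).+1 | i <- enum 'I_n].

Definition perm_des (n : nat) (w : 'S_n) : {set 'I_n.-1} :=
  [set i : 'I_n.-1 | (nth 0 (word w) i.+1 < nth 0 (word w) i)%N].

Definition gperm := {n : nat & 'S_n}.
Definition gperm_of (n : nat) (w : 'S_n) : gperm := Tagged (fun n => 'S_n) w.

Definition FQSym := {malg gperm}.

Definition FQSym_one : FQSym := << gperm_of (1%g : 'S_0) >>.

Definition FQSym_mul : FQSym -> FQSym -> FQSym :=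
  bilinext (fun u v : gperm =>
    \sum_(w : 'S_(tag u + tag v) |
          is_shuffle (word (tagged u)) (map (addn (tag u)) (word (tagged v)))
                     (word w)) << gperm_of w >>).

Definition alternating (s : seq int) : bool :=
  let t := [seq x <- s | x != 0] in
  [&& all (mem [:: 0; 1; -1]) s, head 0 t == 1, last 0 t == 1
    & sorted (fun x y => y == - x) t].

Definition is_asm (n : nat) (A : 'M[int]_n) : bool :=
  [forall i, alternating [seq A i j | j <- enum 'I_n]] &&
  [forall j, alternating [seq A i j | i <- enum 'I_n]].

Record asm (n : nat) := ASM_ { asm_mx :> 'M[int]_n; _ : is_asm asm_mx }.
HB.instance Definition _ n := [isSub for @asm_mx n].
HB.instance Definition _ n := [Countable of asm n by <:].

Section AsmFinite.
Variable n : nat.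

Let code (A : asm n) : 'M['I_3]_n := map_mx (fun x : int => inord `|(x + 1)%R|%N) A.
Let decode (B : 'M['I_3]_n) : option (asm n) :=
  insub (map_mx (fun i : 'I_3 => (val i)%:Z - 1) B).

Let codeK : pcancel code decode.
Proof.
move=> A; rewrite /decode (_ : map_mx _ _ = A) ?valK //; case: A => A asmA.
apply/matrixP=> i j; rewrite !mxE /=.
have /andP[/forallP/(_ i)/and4P[/allP/(_ (A i j)) + _ _ _] _] := asmA.
rewrite (map_f (fun j => A i j)) ?mem_enum // => /(_ isT).
by rewrite !inE => /or3P[]/eqP-> /=; rewrite inordK.
Qed.

HB.instance Definition _ : isFinite (asm n) := PCanIsFinite codeK.
End AsmFinite.

Definition gasm := {n : nat & asm n}.
Definition gasm_of (n : nat) (A : asm n) : gasm := Tagged asm A.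

Lemma alternating_delta n (k : 'I_n) :
  alternating [seq (i == k)%:R | i <- enum 'I_n].
Proof.
rewrite /alternating; set t := filter _ _.
have -> : t = [:: 1].
  rewrite /t filter_map (eq_filter (_ : _ =1 pred1 k)) => [|i /=]; last first.
    by case: (i == k).
  by rewrite filter_pred1_uniq ?enum_uniq ?mem_enum //= eqxx.
rewrite !andbT; apply/allP=> _ /mapP[i _ ->].
by case: (i == k).
Qed.

Fact perm_mx_is_asm n (w : 'S_n) : is_asm (perm_mx w : 'M[int]_n).
Proof.
apply/andP; split; apply/forallP=> k.
  rewrite (_ : [seq _ | _ <- _] = [seq (i == w k)%:R | i <- enum 'I_n]).
    exact: alternating_delta.
  by apply: eq_map => i; rewrite !mxE eq_sym.
rewrite (_ : [seq _ | _ <- _] = [seq (i == (w^-1)%g k)%:R | i <- enum 'I_n]).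
  exact: alternating_delta.
by apply: eq_map => i; rewrite !mxE -(inj_eq (@perm_inj _ w) i) permKV.
Qed.

(* [perm_mx w] has its entry 1 of row [k] in column [w k]. *)
Definition perm_asm (n : nat) (w : 'S_n) : asm n := ASM_ (perm_mx_is_asm w).

(* The partial column sums of an alternating sign matrix are 0 or 1. *)
Definition mtriangle (n : nat) (A : 'M[int]_n) (m : nat) : {set 'I_n} :=
  [set j | \sum_(i < n | (i < m)%N) A i j == 1].

(* [zip] discards the last entry of [b], which is one longer than [0 :: a]. *)
Definition hmin (a b : seq nat) : seq nat :=
  [seq maxn p.1 p.2 | p <- zip (0%N :: a) b].

(* The ordinal [i] stands for k = i.+1. *)
Definition mt_des (n : nat) (T : nat -> {set 'I_n}) : {set 'I_n.-1} :=
  [set i : 'I_n.-1 | elems (T i.+1) != hmin (elems (T i)) (elems (T i.+2))].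

Definition asm_des (n : nat) (A : asm n) : {set 'I_n.-1} := mt_des (mtriangle A).

Definition ASM := {malg gasm}.

Definition ASM_one : ASM := << gasm_of (perm_asm (1%g : 'S_0)) >>.

Definition mxrows (p q : nat) (M : 'M[int]_(p, q)) : seq 'rV[int]_q :=
  [seq row i M | i <- enum 'I_p].
Definition mxcols (p q : nat) (M : 'M[int]_(p, q)) : seq 'cV[int]_p :=
  [seq col j M | j <- enum 'I_q].

Definition ASM_mul : ASM -> ASM -> ASM :=
  bilinext (fun A B : gasm =>
    let a := tag A in let b := tag B in
    \sum_(C : asm (a + b) |
          is_shuffle (mxrows (row_mx (tagged A) (0 : 'M_(a, b))))
                     (mxrows (row_mx (0 : 'M_(b, a)) (tagged B)))
                     (mxrows C)) << gasm_of C >>).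

Definition first_rows (n : nat) (i : 'I_n.+1) (A : 'M[int]_n) : 'M[int]_(i, n) :=
  rowsub (fun k => cast_ord (subnKC (leq_ord i)) (lshift (n - i) k)) A.
Definition last_rows (n : nat) (i : 'I_n.+1) (A : 'M[int]_n) :
    'M[int]_(n - i, n) :=
  rowsub (fun k => cast_ord (subnKC (leq_ord i)) (rshift i k)) A.

(* [N] is obtained from [M] by deleting the zero columns; for a square [N] this
   forces the result of the deletion to be square. *)
Definition del_zero_cols (p q r : nat) (M : 'M[int]_(p, q)) (N : 'M[int]_(p, r)) :=
  mxcols N == [seq c <- mxcols M | c != 0].

(* [B] and [C] are A'_i and A''_i.  For each [i] there is at most one pair (B, C), and there is one exactly when
   both deletions give square matrices. *)
Definition ASM_coprod : ASM -> {malg (gasm * gasm)%type} :=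
  linext (fun A : gasm =>
    let n := tag A in
    \sum_(i < n.+1)
      \sum_(B : asm i | del_zero_cols (first_rows i (tagged A)) B)
        \sum_(C : asm (n - i) | del_zero_cols (last_rows i (tagged A)) C)
          << (gasm_of B, gasm_of C) >>).

Definition ASM_counit : ASM -> int :=
  linext (fun A : gasm => (tag A == 0)%N%:R : int).

Definition FQSym_to_ASM : {additive FQSym -> ASM} :=
  linext (fun w : gperm => << gasm_of (perm_asm (tagged w)) >>).

Definition FQSym_to_QSym : {additive FQSym -> QSym} :=
  linext (fun w : gperm => fundamental (comp_of_set (perm_des (tagged w)))).

Definition ASM_to_QSym : {additive ASM -> QSym} :=
  linext (fun A : gasm => fundamental (comp_of_set (asm_des (tagged A)))).

(* Main.v *)
Require Import Defs.
From HB Require Import structures.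
From mathcomp Require Import all_boot all_order all_algebra all_fingroup.
From mathcomp Require Import finmap monalg.
From mathcomp Require Import zify.

(** Descents of an alternating sign matrix are local in its rows. The number of
    elements of T_m that are at most j is the corner sum c_m(j) of the first m
    rows and j columns, and for H_min(T_{k-1}, T_{k+1}) this number is
    min(c_{k-1}(j) + 1, c_{k+1}(j)). As the left partial sums of a row are 0
    or 1, k fails to be a descent exactly when, for all j, the partial sum of
    row k+1 up to j is at most that of row k ([asm_des_descents]). So Des(A) is
    the descent set of the word of rows of A over the partially ordered set of
    row vectors, ordered by comparing partial sums ([rowle]). A permutation
    matrix gives back the descents of the permutation ([asm_des_perm]), and when
    the rows of A are padded with zeros on the right and those of B on the left,
    every row coming from A lies strictly below every row coming from B
    ([rowle_upper_lower]).

    Both products are therefore instances of one statement on words over a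
    poset ([series_mul_descents]): if every letter of u lies strictly below
    every letter of v, then the product of the fundamental quasisymmetric
    functions of Des(u) and Des(v) is the sum of those of Des(w), for w running
    over the interleavings of u and v. Indeed the coefficient of a monomial m in
    L_{Des(w)} is 1 or 0, and it is 1 when the weakly increasing list s of the
    variables of m, with multiplicities, has the length of w and makes the list
    of pairs (s_i, w_i) lexicographically sorted ([series_descents]). Splitting
    a sorted list of pairs into its letters from u and from v, and merging two
    such lists, are mutually inverse ([fits_mask], [fits_interleave],
    [fits_mask_inj]).

    The map is not comultiplicative because of the 3 by 3 alternating sign matrix
    with an entry -1: no cut of its rows into 1 + 2 gives square pieces
    ([cross_no_cut]), whereas the fundamental function of any composition of 3
    contains M_{111}, whose coproduct contains M_1 (x) M_{11}. *)

Set Implicit Arguments.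
Unset Strict Implicit.
Unset Printing Implicit Defensive.
Import GRing.Theory.
Local Open Scope ring_scope.

(** * Interleavings of two sequences *)
Section Interleave.
Local Open Scope nat_scope.
Implicit Types (T : Type) (t : bitseq).

(** The shuffle of [u] and [v] whose letters marked [true] in [t] come from [u];
    it is meaningful when [marks t u v] holds. *)
Fixpoint interleave T t (u v : seq T) : seq T :=
  if t is b :: t' then
    if b then (if u is x :: u' then x :: interleave t' u' v else [::])
    else (if v is y :: v' then y :: interleave t' u v' else [::])
  else [::].

Definition marks T t (u v : seq T) :=
  (count id t == size u) && (count negb t == size v).

Lemma marks_ind T (P : bitseq -> seq T -> seq T -> Prop) :
    P [::] [::] [::] ->
    (forall t x u v, marks t u v -> P t u v -> P (true :: t) (x :: u) v) ->
    (forall t y u v, marks t u v -> P t u v -> P (false :: t) u (y :: v)) ->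
  forall t u v, marks t u v -> P t u v.
Proof.
move=> P0 P1 P2; elim=> [|b t IH] u v.
  by case: u => [|? ?]; case: v => [|? ?] // /andP[].
case: b; rewrite /marks /= ?add0n ?add1n.
  by case: u => [|x u] // m; apply: P1 => //; apply: IH.
by case: v => [|y v]; rewrite ?andbF // => m; apply: P2 => //; apply: IH.
Qed.

Lemma count_negb t : count negb t = size t - count id t.
Proof. by rewrite -(count_predC id t) addKn. Qed.

Lemma marks_tuple T (u v : seq T) (t : (size u + size v).-tuple bool) :
  count id t == size u -> marks t u v.
Proof. by move=> /eqP c; rewrite /marks count_negb size_tuple c addKn !eqxx. Qed.

Lemma size_marks T t (u v : seq T) :
  marks t u v -> size t = size u + size v.
Proof. by case/andP=> /eqP<- /eqP<-; rewrite count_predC. Qed.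

Lemma marks_mask T t (s : seq T) : size t = size s ->
  marks t (mask t s) (mask (map negb t) s).
Proof.
by move=> e; rewrite /marks !size_mask ?size_map // count_map !eqxx.
Qed.

Lemma size_interleave T t (u v : seq T) : marks t u v -> size (interleave t u v) = size t.
Proof. by elim/marks_ind=> //= *; congr _.+1. Qed.

Lemma mask_interleave T t (u v : seq T) : marks t u v ->
  mask t (interleave t u v) = u /\ mask (map negb t) (interleave t u v) = v.
Proof. by elim/marks_ind=> // {}t x {}u {}v _ /= [-> ->]. Qed.

Lemma interleave_mask T t (s : seq T) : size t = size s ->
  interleave t (mask t s) (mask (map negb t) s) = s.
Proof. by elim: t s => [|[] t IH] [|x s] //= [/IH->]. Qed.

Lemma map_interleave T T' (f : T -> T') t u v :
  map f (interleave t u v) = interleave t (map f u) (map f v).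
Proof. by elim: t u v => [|[] t IH] [|x u] [|y v] //=; rewrite IH. Qed.

Lemma zip_interleave T T' t (s1 s2 : seq T) (u v : seq T') :
    size s1 = size u -> size s2 = size v ->
  zip (interleave t s1 s2) (interleave t u v) = interleave t (zip s1 u) (zip s2 v).
Proof.
elim: t s1 s2 u v => [|[] t IH] //= s1 s2 u v.
  by case: s1 u => [|x s1] [|y u] //= [e] e'; rewrite IH.
by case: s2 v => [|x s2] [|y v] //= e [e']; rewrite IH.
Qed.

Lemma all_interleave T (p : pred T) t (u v : seq T) : marks t u v ->
  all p (interleave t u v) = all p u && all p v.
Proof. by elim/marks_ind=> //= {}t x {}u {}v _ ->; [rewrite andbA | rewrite andbCA]. Qed.

Lemma perm_interleave (T : eqType) t (u v : seq T) : marks t u v ->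
  perm_eq (interleave t u v) (u ++ v).
Proof.
elim/marks_ind=> //= {}t x {}u {}v _ IH; first by rewrite perm_cons.
by rewrite perm_sym -cat1s perm_catCA /= perm_cons perm_sym.
Qed.

Lemma filter_interleave_l T (p : pred T) t (u v : seq T) : marks t u v ->
  filter p v = [::] -> filter p (interleave t u v) = filter p u.
Proof.
by elim/marks_ind=> //= {}t x {}u {}v _ IH; [move/IH-> | case: ifP].
Qed.

Lemma filter_interleave_r T (p : pred T) t (u v : seq T) : marks t u v ->
  filter p u = [::] -> filter p (interleave t u v) = filter p v.
Proof.
by elim/marks_ind=> //= {}t x {}u {}v _ IH; [case: ifP | move/IH->].
Qed.

Lemma interleave_inj (T : eqType) t t' (u v : seq T) : {in u, forall x, x \notin v} ->
  marks t u v -> marks t' u v -> interleave t u v = interleave t' u v -> t = t'.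
Proof.
move=> uv m; elim/marks_ind: m t' uv => {t u v} [|t x u v _ IH|t y u v _ IH] [|b t'] uv //.
- by case: b; rewrite /marks /= ?andbF.
- case: b; rewrite /marks /= ?add0n ?add1n ?eqSS => m.
    by case=> /IH-> // z zu; apply: uv; rewrite inE zu orbT.
  case: v uv {IH m} => // z w /(_ x (mem_head _ _)) + [e].
  by rewrite e mem_head.
case: b; rewrite /marks /= ?add0n ?add1n ?eqSS => m; last first.
  by case=> /IH-> // z zu; have := uv z zu; rewrite inE; case/norP.
case: u uv {IH m} => // z u /(_ z (mem_head _ _)) + [e].
by rewrite e mem_head.
Qed.

Lemma is_shuffleP (T : eqType) (u v s : seq T) :
  reflect (exists2 t : bitseq, marks t u v & s = interleave t u v) (is_shuffle u v s).
Proof.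
apply: (iffP existsP) => [[t /andP[/eqP<- /eqP<-]]|[t m ->]].
  by exists t; rewrite ?marks_mask ?interleave_mask ?size_tuple.
have st : size t == size (interleave t u v) by rewrite size_interleave.
by exists (Tuple st) => /=; have [-> ->] := mask_interleave m; rewrite !eqxx.
Qed.

Lemma count_masks (p : pred nat) t (s : seq nat) : size t = size s ->
  count p (mask t s) + count p (mask (map negb t) s) = count p s.
Proof.
move=> e0; rewrite -count_cat -{3}(interleave_mask e0); apply/esym/seq.permP.
exact/perm_interleave/marks_mask.
Qed.

Lemma ord_next_subproof n (k : 'I_n.-1) : k.+1 < n.
Proof. by case: n k => [[]|n] // k; apply: (ltn_ord k). Qed.
End Interleave.

(** Reindexing along a bijection that is only given by its graph [R]; it spares
    the construction of the inverse as a total function between finite types. *)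
Lemma eq_big_correspondence (V : nmodType) (I J : finType) (P : pred I) (Q : pred J)
    (R : I -> J -> bool) (F : I -> V) (G : J -> V) :
    (forall i j, R i j -> [/\ P i, Q j & F i = G j]) ->
    (forall i, P i -> exists j, R i j) -> (forall j, Q j -> exists i, R i j) ->
    (forall i j j', R i j -> R i j' -> j = j') ->
    (forall i i' j, R i j -> R i' j -> i = i') ->
  \sum_(i | P i) F i = \sum_(j | Q j) G j.
Proof.
move=> RPQ PR QR Rf Rg; transitivity (\sum_(i | P i) \sum_(j | R i j) F i).
  apply: eq_bigr => i /PR[j Rij]; rewrite (big_pred1 j) // => j' /=.
  by apply/idP/eqP => [/(Rf _ _ _ Rij)->|->].
rewrite (exchange_big_dep Q) /= => [|i j _ /RPQ[] //].
apply: eq_bigr => j /QR[i Rij]; have [Pi _ e] := RPQ _ _ Rij.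
rewrite (big_pred1 i) // => i' /=; apply/andP/eqP => [[_]|->//].
by move/(Rg _ _ _ Rij)->.
Qed.

(** Sums over combinatorial objects that are shuffles, once read as sequences
    through [f], become sums over marks: as [u] and [v] have no common letter, a
    shuffle determines its marks. *)
Lemma big_is_shuffle (T : eqType) (I : finType) (V : nmodType) (u v : seq T)
    (f : I -> seq T) (F : I -> V) (G : seq T -> V) :
    injective f ->
    (forall t, marks t u v -> exists i, f i = interleave t u v) ->
    {in u, forall x, x \notin v} -> (forall i, F i = G (f i)) ->
  \sum_(i | is_shuffle u v (f i)) F i =
  \sum_(t : (size u + size v).-tuple bool | count id t == size u) G (interleave t u v).
Proof.
move=> injf surj uv FG.
apply: (eq_big_correspondence (R := fun i (t : (size u + size v).-tuple bool) =>
  (count id t == size u) && (f i == interleave t u v))).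
- move=> i t /andP[c /eqP e]; rewrite FG e c; split=> //.
  by apply/is_shuffleP; exists t; first exact: marks_tuple.
- move=> i /is_shuffleP[t m e]; have st : size t == size u + size v by rewrite (size_marks m).
  by exists (Tuple st); rewrite /= e eqxx andbT; case/andP: m.
- move=> t c; have [i e] := surj _ (marks_tuple c).
  by exists i; rewrite c e eqxx.
- move=> i t t' /andP[c /eqP->] /andP[c' /eqP e].
  by apply/val_inj/(interleave_inj uv); rewrite ?marks_tuple.
- by move=> i i' t /andP[_ /eqP e] /andP[_ /eqP]; rewrite -e => /injf.
Qed.

(** * Lexicographically sorted words over a poset *)
Section Words.
Local Open Scope nat_scope.

(** The merge step of merge sort. Only letters of different sequences have to be
    comparable, the order being partial. *)
Lemma merge_exists (T : eqType) (r : rel T) (u v : seq T) :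
    transitive r -> pairwise r u -> pairwise r v ->
    {in u & v, forall x y, r x y || r y x} ->
  exists2 t, marks t u v & pairwise r (interleave t u v).
Proof.
move=> tr; elim: u v => [|x u IHu].
  move=> v _ pv _; exists (nseq (size v) false).
    by rewrite /marks !count_nseq /= ?mul0n ?mul1n !eqxx.
  rewrite (_ : interleave _ _ _ = v) //.
  by elim: v {pv} => //= y v ->.
elim=> [|y v IHv] pu pv ruv.
  exists (nseq (size u).+1 true); first by rewrite /marks !count_nseq /= ?mul0n ?mul1n !eqxx.
  rewrite (_ : interleave _ _ _ = x :: u) //=; congr (_ :: _).
  by elim: (u) => //= z w ->.
case/orP: (ruv x y (mem_head _ _) (mem_head _ _)) => [rxy|ryx].
- have [|//||t m p] := IHu (y :: v); first by case/andP: pu.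
    by move=> z w zu; apply: ruv; rewrite inE zu orbT.
  exists (true :: t); first by rewrite /marks /= add0n add1n eqSS.
  rewrite /= p andbT all_interleave //= rxy /=.
  case/andP: pu => -> _ /=; case/andP: pv => /allP ay _.
  by apply/allP=> z /ay; apply: tr.
have [//||t m p] := IHv pu; first by case/andP: pv.
  by move=> z w zu wv; apply: ruv; rewrite // inE wv orbT.
exists (false :: t); first by rewrite /marks /= add0n add1n eqSS.
rewrite /= p andbT all_interleave //= ryx /=.
case/andP: pv => -> _ /=; case/andP: pu => /allP ax _; rewrite andbT.
by apply/allP=> z /ax; apply: tr.
Qed.

Definition lexrel T (e : rel T) : rel (nat * T) :=
  fun p q => (p.1 < q.1) || (p.1 == q.1) && e p.2 q.2.

Lemma lexrel_trans T (e : rel T) : transitive e -> transitive (lexrel e).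
Proof.
move=> tr [b y] [a x] [c z]; rewrite /lexrel /=.
case/orP=> [ab|/andP[/eqP-> exy]] /orP[bc|/andP[/eqP<- eyz]].
- by rewrite (ltn_trans ab).
- by rewrite ab.
- by rewrite bc.
- by rewrite eqxx (tr _ _ _ exy eyz) orbT.
Qed.

Lemma lexrel_anti T (e : rel T) : antisymmetric e -> antisymmetric (lexrel e).
Proof.
move=> an [a x] [b y]; rewrite /lexrel /=.
case: (ltngtP a b) => //= <- /an-> //.
Qed.

Lemma lexrel_fst T (e : rel T) p q : lexrel e p q -> p.1 <= q.1.
Proof. by case/orP => [/ltnW//|/andP[/eqP-> _]]. Qed.

(** For [e] an order, [fits e s w] says that the (s_i, w_i) are sorted, i.e. that
    [s] is a P-partition for [w]: it increases weakly, and strictly at the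
    descents of [w]. Such [s] index the monomials of the fundamental function of
    the descent set of [w]. *)
Definition fits T (e : rel T) (s : seq nat) (w : seq T) :=
  (size s == size w) && sorted (lexrel e) (zip s w).

Lemma fits_sorted T (e : rel T) s w : fits e s w -> sorted leq s.
Proof.
case/andP=> /eqP sz; rewrite -{2}(@unzip1_zip _ _ s w) ?sz // /unzip1 sorted_map.
by apply: sub_sorted => p q /lexrel_fst.
Qed.

Section Ordered.
Variables (T : eqType) (e : rel T) (u v : seq T).
Hypotheses (e_trans : transitive e) (e_anti : antisymmetric e).
Hypothesis uv : {in u & v, forall x y, e x y && ~~ e y x}.

Lemma ordered_disjoint : {in u, forall x, x \notin v}.
Proof. by move=> x xu; apply/negP=> /(uv xu)/andP[-> ]. Qed.

(** The pairs of the two parts can be merged, since a letter of [u] and one of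
    [v] are always comparable. The first components of the merge are sorted, so
    they form [s]. *)
Lemma fits_interleave s s1 s2 : fits e s1 u -> fits e s2 v ->
    sorted leq s -> perm_eq (s1 ++ s2) s ->
  exists t, [/\ marks t u v, s1 = mask t s, s2 = mask (map negb t) s
              & fits e s (interleave t u v)].
Proof.
have lt := lexrel_trans e_trans.
case/andP=> /eqP z1 so1 /andP[/eqP z2 so2] so pe.
case: (@merge_exists _ (lexrel e) (zip s1 u) (zip s2 v)) => //.
- by rewrite -sorted_pairwise.
- by rewrite -sorted_pairwise.
- move=> [a x] [b y] /(map_f snd) + /(map_f snd); rewrite /= -/(unzip2 _) -/(unzip2 _).
  rewrite !unzip2_zip ?z1 ?z2 // /lexrel /= => xu yv; have /andP[-> _] := uv xu yv.
  by case: (ltngtP a b).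
move=> t m; have m' : marks t u v by move: m; rewrite /marks !size_zip z1 z2 !minnn.
have m'' : marks t s1 s2 by rewrite /marks z1 z2.
rewrite -zip_interleave // => p.
have es : interleave t s1 s2 = s.
  apply: (sorted_eq leq_trans anti_leq) => //; last first.
    exact: perm_trans (perm_interleave m'') pe.
  apply: (@fits_sorted _ e _ (interleave t u v)).
  by rewrite /fits !size_interleave // eqxx sorted_pairwise.
exists t; have [] := mask_interleave m''; rewrite es => -> ->.
by split=> //; rewrite /fits -{2}es sorted_pairwise // p -es !size_interleave ?eqxx.
Qed.

(** A subsequence of a sorted sequence is sorted. *)
Lemma fits_mask s t : marks t u v -> fits e s (interleave t u v) ->
  fits e (mask t s) u && fits e (mask (map negb t) s) v.
Proof.
have lt := lexrel_trans e_trans.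
move=> m /andP[/eqP sz so]; rewrite size_interleave // in sz.
have m' := marks_mask (esym sz).
have [z1 z2] : size (mask t s) = size u /\ size (mask (map negb t) s) = size v.
  by case/andP: m' => /eqP<- /eqP<-; case/andP: m => /eqP-> /eqP->.
have E : zip s (interleave t u v) = interleave t (zip (mask t s) u) (zip (mask (map negb t) s) v).
  by rewrite -zip_interleave // interleave_mask.
have mm : marks t (zip (mask t s) u) (zip (mask (map negb t) s) v).
  by move: m; rewrite /marks !size_zip z1 z2 !minnn.
rewrite E in so; have [e1 e2] := mask_interleave mm.
rewrite /fits z1 z2 !eqxx /=; apply/andP; split.
  by rewrite -e1 sorted_mask.
by rewrite -e2 sorted_mask.
Qed.

(** Both sequences of pairs are sorted rearrangements of the same multiset, hence
    equal by antisymmetry; the disjointness of [u] and [v] then gives the marks. *)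
Lemma fits_mask_inj s t t' : marks t u v -> marks t' u v ->
    fits e s (interleave t u v) -> fits e s (interleave t' u v) ->
  mask t s = mask t' s -> mask (map negb t) s = mask (map negb t') s -> t = t'.
Proof.
have lt := lexrel_trans e_trans.
have E t0 : marks t0 u v -> fits e s (interleave t0 u v) ->
    perm_eq (zip s (interleave t0 u v)) (zip (mask t0 s) u ++ zip (mask (map negb t0) s) v).
  move=> m /[dup] /(fits_mask m) /andP[/andP[/eqP z1 _] /andP[/eqP z2 _]] /andP[/eqP sz _].
  rewrite -{1}(@interleave_mask _ t0 s) ?sz ?size_interleave // zip_interleave //.
  by apply: perm_interleave; move: m; rewrite /marks !size_zip z1 z2 !minnn.
move=> m m' f f' e1 e2; apply: (interleave_inj ordered_disjoint m m').
have := E _ m f; rewrite e1 e2 perm_sym; move: (E _ m' f') => p p'.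
have : zip s (interleave t u v) = zip s (interleave t' u v).
  case/andP: f f' => _ so /andP[_ so'].
  apply: (sorted_eq lt (lexrel_anti e_anti)) => //.
  by rewrite perm_sym (perm_trans p).
case/andP: f f' => /eqP sz _ /andP[/eqP sz' _].
by move/(congr1 (@unzip2 _ _)); rewrite !unzip2_zip -?sz -?sz'.
Qed.

End Ordered.
End Words.

(** * Compositions, partial sums and refinement *)
Section Sums.
Local Open Scope nat_scope.
Implicit Types (s a b : seq nat).

(** The partial sums start at the first part and end at the total, so that on
    positive parts they form a strictly increasing list without 0. *)
Definition sums s := scanl addn 0 s.
Arguments sums : simpl never.

Lemma scanl_addn x s : scanl addn x s = map (addn x) (sums s).
Proof.
rewrite /sums; elim: s x => //= y s IH x; rewrite add0n IH (IH y) -map_comp.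
by congr (_ :: _); apply: eq_map => z /=; rewrite addnA.
Qed.

Lemma sums_cons x s : sums (x :: s) = x :: map (addn x) (sums s).
Proof. by rewrite {1}/sums /= add0n scanl_addn. Qed.

Lemma last_sums s : last 0 (sums s) = sumn s.
Proof.
elim: s => // x s; rewrite sums_cons /= => <-.
case: (sums s) => [|y t] /=; first by rewrite addn0.
by rewrite last_map.
Qed.

Lemma sums_inj : injective sums.
Proof. by apply: can_inj (scanlK (f := fun x y => y - x) _ 0) => x; apply: addKn. Qed.

Lemma sums_differences x s : path ltn x s ->
  scanl addn x (pairmap (fun x y => y - x) x s) = s.
Proof. by elim: s x => //= y s IH x /andP[/ltnW/subnKC-> /IH->]. Qed.

Lemma path_sums s : all (leq 1) s -> path ltn 0 (sums s).
Proof.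
rewrite /sums; have: forall x, all (leq 1) s -> path ltn x (scanl addn x s); last exact.
elim: s => //= y s IH x /andP[y0 /IH->].
by rewrite -[X in X < _]addn0 ltn_add2l y0.
Qed.

Lemma sumn_in_sums s : 0 < sumn s -> sumn s \in sums s.
Proof.
rewrite -last_sums; case: (sums s) => //= x t _; exact: mem_last.
Qed.

Lemma sums_le s x : x \in sums s -> x <= sumn s.
Proof.
elim: s x => //= y s IH x; rewrite sums_cons inE => /predU1P[->|/mapP[z /IH zs ->]].
  exact: leq_addr.
by rewrite leq_add2l.
Qed.

Lemma sums_take s x : (x \in sums s) -> exists2 k, k <= size s & x = sumn (take k s).
Proof.
elim: s x => //= y s IH x; rewrite sums_cons inE => /predU1P[->|/mapP[z /IH[k le ->] ->]].
  by exists 1; rewrite ?take0 //= take0 addn0.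
by exists k.+1.
Qed.

Lemma take_sums s k : 0 < sumn (take k s) -> sumn (take k s) \in sums s.
Proof.
elim: s k => //= y s IH [|k] //= _; rewrite sums_cons inE.
case: (posnP (sumn (take k s))) => [->|/IH]; first by rewrite addn0 eqxx.
by move/(map_f (addn y))->; rewrite orbT.
Qed.

(** Blocks may be empty, which is why 0 has to be added on the right. *)
Lemma reshape_sums sh b : sumn sh = size b ->
  {subset sums [seq sumn c | c <- reshape sh b] <= 0 :: sums b}.
Proof.
elim: sh b => //= k sh IH b e; move=> x; rewrite sums_cons inE.
have mem_take0 j : sumn (take j b) \in 0 :: sums b.
  by rewrite inE; case: posnP => //= /take_sums.
case/predU1P=> [->//|/mapP[y /IH]].
rewrite size_drop -e addKn => /(_ erefl); rewrite inE => /predU1P[->|].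
  by rewrite addn0 => ->.
by case/sums_take=> j _ ->; rewrite -sumn_cat -takeD => ->; apply: mem_take0.
Qed.

(** Positivity of the parts of [b] makes the block boundaries increase, so the
    first block can be cut off and the rest handled by induction. *)
Lemma sums_reshape a b : all (leq 1) a -> all (leq 1) b -> sumn a = sumn b ->
    {subset sums a <= sums b} ->
  exists sh, [/\ size sh = size a, sumn sh = size b & [seq sumn c | c <- reshape sh b] = a].
Proof.
elim: a b => [|x a IH] b /=.
  move=> _; case: b => [|y b] /=; first by exists [::].
  by case: y.
case/andP=> x0 a0 b0 e sub; have := sub x; rewrite sums_cons mem_head => /(_ isT).
case/sums_take=> k kb ex.
have eb := cat_take_drop k b; set b1 := take k b in eb ex; set b2 := drop k b in eb.
have b20 : all (leq 1) b2 by move: b0; rewrite -eb all_cat => /andP[].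
have [||sh [s1 s2 s3]] := IH b2 a0 b20.
- by apply: (@addnI x); rewrite e -eb sumn_cat ex.
- move=> y ya.
  have : x + y \in sums b by apply: sub; rewrite sums_cons inE (map_f (addn x) ya) orbT.
  have y0 : 0 < y.
    by have /path_sums := a0; rewrite (path_sortedE ltn_trans) => /andP[/allP/(_ y ya)].
  move=> xy; have [j _ ej] := sums_take xy.
  have : y = sumn (take (j - k) b2).
    move: ej; rewrite -eb take_cat size_takel //; case: ltnP => [jk|kj].
      move=> exy; exfalso; have : x + y <= x.
        rewrite {2}ex exy -{2}(cat_take_drop j b1) sumn_cat; exact: leq_addr.
      by rewrite -{2}[x]addn0 leq_add2l leqNgt y0.
    by rewrite sumn_cat -ex => /addnI.
  by move=> ey; rewrite ey; apply: take_sums; rewrite -ey.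
exists (k :: sh); split=> /=; first by rewrite s1.
  by rewrite s2 size_drop subnKC.
by rewrite -/b1 -/b2 s3 -ex.
Qed.

End Sums.

(** Refinement is inclusion of the sets of partial sums, a form in which the
    choice of the blocks has disappeared. *)
Lemma refinesE (b a : composition) :
  refines b a = (sumn b == sumn a) && all (mem (sums b)) (sums a).
Proof.
apply/existsP/andP => [[sh /andP[/eqP e1 /eqP e2]]|[/eqP e /allP sub]].
  split.
    by rewrite -(congr1 sumn e2) -sumn_flatten reshapeKr ?e1.
  apply/allP=> x xa; have := @reshape_sums _ b e1 x; rewrite e2 inE => /(_ xa)/predU1P[x0|//].
  have /path_sums := parts_gt0 a; rewrite (path_sortedE ltn_trans) => /andP[/allP/(_ x xa)].
  by rewrite x0.
have [sh [s1 s2 s3]] := sums_reshape (parts_gt0 a) (parts_gt0 b) (esym e) sub.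
have bnd i : i \in sh -> (i < (size b).+1)%N.
  by rewrite ltnS -s2; elim: (sh) i => //= j l IH i; rewrite inE => /predU1P[->|/IH le];
    rewrite ?leq_addr // (leq_trans le) ?leq_addl.
have vals : [seq val i | i <- [seq (inord i : 'I_(size b).+1) | i <- sh]] = sh.
  by rewrite -map_comp -[RHS]map_id; apply/eq_in_map=> i /bnd lt /=; rewrite inordK.
have st : size [seq (inord i : 'I_(size b).+1) | i <- sh] == size a by rewrite size_map s1.
by exists (Tuple st); rewrite /= vals s2 s3 !eqxx.
Qed.

Section CompOfSet.
Local Open Scope nat_scope.

Lemma mem_elems p (J : {set 'I_p}) (i : 'I_p) : ((val i).+1 \in elems J) = (i \in J).
Proof.
rewrite /elems (mem_map (f := fun i : 'I_p => (val i).+1)) ?mem_enum //.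
by move=> x y [/val_inj].
Qed.

Lemma path_differences x s :
  all (leq 1) (pairmap (fun x y => y - x) x s) -> path ltn x s.
Proof. by elim: s x => //= y s IH x /andP[]; rewrite subn_gt0 => -> /IH. Qed.

Lemma path_elems p (J : {set 'I_p}) : path ltn 0 (rcons (elems J) p.+1).
Proof. exact/path_differences/(@comp_parts_gt0 p.+1). Qed.

Lemma elems_sorted p (J : {set 'I_p}) : sorted ltn (elems J).
Proof. by have := path_elems J; rewrite rcons_path => /andP[/path_sorted]. Qed.

Variable n : nat.
Implicit Types J : {set 'I_n.-1}.

Lemma sums_comp_of_set J : sums (comp_of_set J) = if n is 0 then [::] else rcons (elems J) n.
Proof. by case: n J => // m J; apply/sums_differences/path_elems. Qed.

Lemma sumn_comp_of_set J : sumn (comp_of_set J) = n.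
Proof.
by rewrite -last_sums sums_comp_of_set; case: n J => //= m J; rewrite last_rcons.
Qed.

Lemma comp_of_set_inj : injective (@comp_of_set n).
Proof.
move=> J J' e; apply/setP=> i; have := congr1 (sums \o parts) e; rewrite /= !sums_comp_of_set.
case: n J J' i {e} => [|m] J J' i; first by case: i.
by case/rcons_inj=> e; rewrite -!mem_elems e.
Qed.

Lemma comp_of_set_surj (c : composition) : sumn c = n -> exists J, comp_of_set J = c.
Proof.
move=> sc; exists [set i : 'I_n.-1 | (val i).+1 \in sums c]; apply/val_inj/sums_inj.
have := path_sums (parts_gt0 c); rewrite (path_sortedE ltn_trans) => /andP[/allP pos so].
rewrite sums_comp_of_set; case: n sc => [|m] sc.
  case E: (sums c) => [//|x s]; have xs : x \in sums c by rewrite E mem_head.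
  by have := leq_trans (pos x xs) (sums_le xs); rewrite sc.
apply: (irr_sorted_eq ltn_trans ltnn) => //.
  exact: path_sorted (path_elems _).
move=> x; rewrite mem_rcons inE; apply/predU1P/idP => [[->|/mapP[i + ->]]|xc].
- by rewrite -sc; apply: sumn_in_sums; rewrite sc.
- by rewrite mem_enum inE.
have := sums_le xc; have := pos x xc; case: x xc => //= x xc _.
rewrite sc leq_eqVlt => /predU1P[->|xm]; [by left | right].
have := mem_elems [set i : 'I_m | i.+1 \in sums c] (Ordinal (xm : x < m)).
by rewrite inE => ->.
Qed.

Lemma refines_comp_of_set J (c : composition) :
  refines c (comp_of_set J) = (sumn c == n) && [forall (i | i \in J), (val i).+1 \in sums c].
Proof.
rewrite refinesE sumn_comp_of_set; case: eqP => //= sc; rewrite sums_comp_of_set.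
case: n J sc => [|m] J sc; first by symmetry; apply/forallP => -[].
rewrite all_rcons /= -sc sumn_in_sums ?sc //=.
apply/allP/forall_inP => [sub i iJ|sub _ /mapP[i + ->]].
  by apply: sub; rewrite mem_elems.
by rewrite mem_enum => /sub.
Qed.

End CompOfSet.

Lemma refines_sumn (c a : composition) : refines c a -> sumn c = sumn a.
Proof. by rewrite refinesE => /andP[/eqP]. Qed.

Lemma mcoeff_fundamental a (c : composition) : (fundamental a)@_c = (refines c a)%:R.
Proof.
rewrite /fundamental raddf_sum /=.
have [sc|/eqP ne] := eqVneq (sumn c) (sumn a); last first.
  rewrite (_ : refines c a = false); last exact: contra_notF (@refines_sumn c a) ne.
  apply: big1 => J _; rewrite mcoeffU; case: eqP => // e.
  by case: ne; rewrite -e sumn_comp_of_set.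
have [J <-] := comp_of_set_surj sc.
under eq_bigr => J' _ do rewrite mcoeffU (inj_eq (@comp_of_set_inj _)).
rewrite big_mkcond (bigD1 J) //= eqxx big1 ?addr0; first by case: refines.
by move=> J' /negPf->; case: refines.
Qed.

(** * Coefficients of the fundamental quasisymmetric functions *)
Section Letters.
Local Open Scope nat_scope.
Implicit Type m : {cmonom nat}.

Definition runs (f : nat -> nat) (l : seq nat) := flatten [seq nseq (f i) i | i <- l].

(** The indices of the variables of [m] in weakly increasing order, each repeated
    according to its exponent. *)
Definition letters m := runs m (sort leq (finsupp m)).

Lemma count_runs f l i : count_mem i (runs f l) = f i * count_mem i l.
Proof.
rewrite /runs; elim: l => //= [|j l IH]; first by rewrite muln0.
rewrite count_cat count_nseq IH mulnDr /=; congr (_ + _).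
by case: eqVneq => [->|_]; rewrite ?mul1n ?muln1 ?muln0.
Qed.

Lemma all_runs p f l : all p l -> all p (runs f l).
Proof. by elim: l => //= x l IH /andP[px /IH al]; rewrite /runs /= all_cat all_nseq px orbT. Qed.

Lemma sorted_runs f l : sorted leq l -> sorted leq (runs f l).
Proof.
rewrite !(sorted_pairwise leq_trans); elim: l => //= x l IH /andP[al /IH pl].
rewrite /runs /= pairwise_cat pl andbT; apply/andP; split.
  by apply/allrelP=> y z /nseqP[-> _] zl; move/(all_runs f)/allP: al; apply.
by elim: (f x) => //= k ->; rewrite all_nseq leqnn orbT.
Qed.

Lemma size_runs f l : size (runs f l) = sumn (map f l).
Proof. by rewrite /runs; elim: l => //= x l IH; rewrite size_cat size_nseq IH. Qed.

(** A strict increase happens exactly where a run ends, and the runs end at the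
    partial sums of their lengths. *)
Lemma runs_ascent f l d : sorted ltn l -> {in l, forall i, 0 < f i} ->
    d.+1 < size (runs f l) ->
  (nth 0 (runs f l) d < nth 0 (runs f l) d.+1) = (d.+1 \in sums (map f l)).
Proof.
elim: l d => // x l IH d so f0; rewrite size_runs [map f _]/= sums_cons /= => lt.
rewrite inE /runs /= -/(runs f l) !nth_cat size_nseq !nth_nseq.
have fx : 0 < f x by apply: f0; rewrite mem_head.
have f0' : {in l, forall i, 0 < f i} by move=> i il; apply: f0; rewrite inE il orbT.
case: (ltngtP d.+1 (f x)) => [dx|xd|dx].
- rewrite ltnn; symmetry; apply/negP => /mapP[y _ e].
  by move: dx; rewrite e ltnNge leq_addr.
- rewrite subSn // IH ?(path_sorted so) //; last first.
    by rewrite size_runs -subSn // ltn_subLR // ltnW.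
  by rewrite -[in RHS](@subnKC (f x) d.+1) ?(ltnW xd) // mem_map ?subSn //; apply: addnI.
rewrite -dx subnn /=.
have sz : 0 < size (runs f l).
  by rewrite size_runs; move: lt; rewrite dx -[X in X < _ -> _]addn0 ltn_add2l.
have /allP := all_runs f (order_path_min ltn_trans so).
by apply; rewrite mem_nth.
Qed.

Lemma sorted_letters m : sorted leq (letters m).
Proof. exact/sorted_runs/(sort_sorted leq_total). Qed.

Lemma count_letters m i : count_mem i (letters m) = m i.
Proof.
rewrite count_runs count_sort count_uniq_mem ?fset_uniq //.
by case: finsuppP => _; rewrite ?muln0 ?muln1.
Qed.

Lemma letters_unique m s : sorted leq s -> (forall i, count_mem i s = m i) -> letters m = s.
Proof.
move=> so cs; apply: (sorted_eq leq_trans anti_leq (sorted_letters m) so).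
by apply/allP=> i _; rewrite /= count_letters cs.
Qed.

Lemma exponents_gt0 m : all (leq 1) (exponents m).
Proof.
by apply/allP=> _ /mapP[i + ->]; rewrite mem_sort mem_finsupp lt0n.
Qed.

Definition exponent_composition m : composition := Composition (exponents_gt0 m).

Lemma size_letters m : size (letters m) = sumn (exponents m).
Proof. exact: size_runs. Qed.

Lemma letters_ascent m d : d.+1 < size (letters m) ->
  (nth 0 (letters m) d < nth 0 (letters m) d.+1) = (d.+1 \in sums (exponent_composition m)).
Proof.
apply: runs_ascent => [|i].
  by rewrite ltn_sorted_uniq_leq sort_uniq fset_uniq sort_sorted //; apply: leq_total.
by rewrite mem_sort mem_finsupp lt0n.
Qed.

End Letters.

Lemma seriesE f m : series f m = f@_(exponent_composition m).
Proof.
rewrite /series /linext [in RHS](monalgE f) raddf_sum /=; apply: eq_bigr => c _.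
rewrite mcoeffU /monomial_series eq_sym -val_eqE /=.
by case: (_ == _); rewrite ?mul0rz // mulrzz mul1r.
Qed.

(** The length [n] is a separate argument, so that descent sets of words whose
    lengths are equal but not convertible live in the same type. *)
Definition descents (T : Type) (x0 : T) (e : rel T) (n : nat) (w : seq T) : {set 'I_n.-1} :=
  [set k : 'I_n.-1 | ~~ e (nth x0 w k) (nth x0 w k.+1)].

(** The exponents of [m] refine the composition of the descent set iff every
    descent is a partial sum of the exponents, i.e. a strict increase of
    [letters m]. *)
Lemma series_descents (T : Type) (x0 : T) (e : rel T) w n m : size w = n ->
  series (fundamental (comp_of_set (descents x0 e n w))) m = (fits e (letters m) w)%:R.
Proof.
move=> sw; rewrite seriesE mcoeff_fundamental refines_comp_of_set /fits size_letters sw.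
case: eqP => //= sm; congr (_%:R); congr (nat_of_bool _).
have sz : size (letters m) = size w by rewrite size_letters sm.
have so := sorted_letters m.
apply/forall_inP/(sortedP (0%N, x0)) => [asc i|asc k].
  rewrite size_zip sz minnn => lt; rewrite !nth_zip // /lexrel /=.
  have := (sortedP 0%N) so i; rewrite sz => /(_ lt); rewrite leq_eqVlt => /predU1P[e0|->//].
  rewrite [X in (X == _)]e0 eqxx /=; case: (boolP (e _ _)); rewrite ?orbT //= => ne.
  have ltk : (i < n.-1)%N by rewrite -sw; case: (size w) lt.
  have := asc (Ordinal ltk); rewrite inE /= => /(_ ne).
  by rewrite -letters_ascent ?sz // => ->.
have lt : (k.+1 < size w)%N by rewrite sw; apply: ord_next_subproof.
rewrite inE -letters_ascent ?sz // => /negPf ne; have := asc k.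
rewrite size_zip sz minnn => /(_ lt); rewrite !nth_zip // /lexrel /= ne andbF orbF //.
Qed.

(** * The product rule for words over a poset *)
Section Product.
Variables (T : eqType) (x0 : T) (e : rel T) (u v : seq T).
Hypotheses (e_trans : transitive e) (e_anti : antisymmetric e).
Hypothesis uv : {in u & v, forall x y, e x y && ~~ e y x}.

(** A factorization of [m] into two monomials amounts to a splitting of the
    multiset [letters m]. Marks [t] split [letters m] by position; the marks for
    which [letters m] fits the interleaving correspond in this way to the
    factorizations whose factors fit [u] and [v]. *)
Lemma series_mul_descents m :
  series_mul (series (fundamental (comp_of_set (descents x0 e (size u) u))))
             (series (fundamental (comp_of_set (descents x0 e (size v) v)))) m =
  \sum_(t : (size u + size v).-tuple bool | count id t == size u)
     series (fundamental (comp_of_set (descents x0 e (size u + size v) (interleave t u v)))) m.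
Proof.
set n := (size u + size v)%N; set s := letters m.
(* [m1 d] is the first factor, with exponents [d]. *)
pose m1 (d : {dffun forall i : finsupp m, 'I_(m (val i)).+1}) :=
  [cmonom nat_of_ord (d i) | i : finsupp m]%M.
have m1E d (i : finsupp m) : m1 d (val i) = d i.
  by rewrite /m1 cmE fsfun_ffun insubT //= => H; congr (nat_of_ord (d _)); apply: val_inj.
have m10 d i : i \notin finsupp m -> m1 d i = 0%N.
  by move=> ni; rewrite /m1 cmE fsfun_ffun insubF //; apply/negbTE.
have m1_le d i : (m1 d i <= m i)%N.
  case: (boolP (i \in finsupp m)) => [im|/m10->//].
  by rewrite -[i]/(val (FSetSub im)) m1E -ltnS ltn_ord.
have s_so : sorted leq s := sorted_letters m.
pose P d := fits e (letters (m1 d)) u && fits e (letters (divcm m (m1 d))) v.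
pose Q (t : n.-tuple bool) := (count id t == size u) && fits e s (interleave t u v).
transitivity (\sum_(d | P d) 1 : int).
  rewrite /series_mul [RHS]big_mkcond; apply: eq_bigr => d _; rewrite -/(m1 d).
  by rewrite !series_descents // -natrM mulnb /P; case: (_ && _).
transitivity (\sum_(t | Q t) 1 : int); last first.
  rewrite big_mkcondr; apply: eq_bigr => t c; have mt := marks_tuple c.
  by rewrite series_descents ?size_interleave ?size_tuple //; case: fits.
have counts d i : (count_mem i (letters (m1 d)) + count_mem i (letters (divcm m (m1 d))) = m i)%N.
  by rewrite !count_letters divcmE subnKC.
apply: (eq_big_correspondence (R := fun d t => [&& Q t, letters (m1 d) == mask t s
   & letters (divcm m (m1 d)) == mask (map negb t) s])).
- move=> d t /and3P[Qt /eqP e1 /eqP e2]; split=> //; case/andP: Qt => c f.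
  by rewrite /P e1 e2 fits_mask // marks_tuple.
- move=> d /andP[f1 f2].
  case: (@fits_interleave _ e u v e_trans uv s _ _ f1 f2 s_so).
    by apply/allP=> i _ /=; rewrite count_cat counts count_letters.
  move=> t [mt e1 e2 f]; have st : size t == n by rewrite (size_marks mt).
  exists (Tuple st); rewrite /Q /= f -e1 -e2 !eqxx !andbT.
  by case/andP: mt.
- move=> t /andP[c f]; have mt := marks_tuple c.
  have sz : size t = size s by case/andP: f => /eqP->; rewrite size_interleave.
  have cm i := count_masks (pred1 i) sz.
  pose d : {dffun forall i : finsupp m, 'I_(m (val i)).+1} :=
    [ffun i => inord (count_mem (val i) (mask t s))].
  (* Outside the support of [m] both sides vanish. *)
  have dE i : m1 d i = count_mem i (mask t s).
    case: (boolP (i \in finsupp m)) => [im|im].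
      rewrite -[i]/(val (FSetSub im)) m1E ffunE inordK // ltnS -[X in (_ <= X)%N]count_letters.
      by rewrite -cm leq_addr.
    rewrite m10 //; have := cm i; rewrite count_letters (fsfun_dflt im).
    by move/eqP; rewrite addn_eq0 => /andP[/eqP-> _].
  exists d; rewrite /Q c f /=; apply/andP; split; apply/eqP/letters_unique.
  + exact: (sorted_mask leq_trans).
  + by move=> i; rewrite dE.
  + exact: (sorted_mask leq_trans).
  + by move=> i; rewrite divcmE dE -[m i]count_letters -cm addKn.
- move=> d t t' /and3P[/andP[c f] /eqP e1 /eqP e2] /and3P[/andP[c' f'] /eqP e1' /eqP e2'].
  apply/val_inj/(fits_mask_inj e_trans e_anti uv _ _ f f').
  + exact: marks_tuple.
  + exact: marks_tuple.
  + by rewrite -e1 -e1'.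
  + by rewrite -e2 -e2'.
move=> d d' t /and3P[_ /eqP e1 _] /and3P[_ /eqP e1' _].
apply/ffunP=> i; apply/val_inj; rewrite /= -!m1E -!count_letters e1 e1' //.
Qed.

End Product.

(** * Partial sums of alternating sequences *)
Lemma filter_enum_ord n j : [seq l <- enum 'I_n | (val l < j)%N] = take j (enum 'I_n).
Proof.
apply: (inj_map val_inj); rewrite map_take.
rewrite -[LHS](filter_map val (fun i => i < j)%N) val_enum_ord take_iota.
have [jn|nj] := leqP j n.
  by have := filter_iota_ltn 0 jn.
by apply/all_filterP/allP=> i; rewrite mem_iota add0n => /andP[_ /ltn_trans]; apply.
Qed.

Lemma sum_take n (f : 'I_n -> int) j :
  \sum_(i < n | (i < j)%N) f i = \sum_(x <- take j [seq f i | i <- enum 'I_n]) x.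
Proof. by rewrite -map_take big_map -filter_enum_ord big_filter big_enum_cond. Qed.

Section Alternating.
Implicit Type s : seq int.

Local Notation nonzero := (filter (fun x : int => x != 0)).

(** After a nonzero entry x the next nonzero ones are -x, x, -x, ..., so that the
    sums of what follows are 0 or -x. The sequence itself may be seen as
    following a fictitious entry -1. *)
Lemma alternating_partial_sum s j : alternating s ->
  ((\sum_(x <- take j s) x == 0) || (\sum_(x <- take j s) x == 1)).
Proof.
suff H x t i : (x == 1) || (x == -1) -> path (fun x y : int => y == - x) x (nonzero t) ->
    let y := \sum_(x <- take i t) x in (y == 0) || (y == - x).
  case/and4P=> _ h _ so; apply: (H (-1)) => //; rewrite /= in h so *.
  by case: (filter _ _) h so => //= y t /eqP-> ->.
elim: t i x => [|z t IH] [|i] x //= hx; rewrite ?big_nil ?eqxx // big_cons.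
case: eqVneq => [->|z0] /=; first by rewrite add0r; apply: IH.
case/andP=> /eqP ez p; have := IH i z _ p; rewrite /= => /(_ _)/orP[|/eqP->|/eqP->].
- by rewrite ez; case/orP: hx => /eqP->.
- by rewrite addr0 ez eqxx orbT.
- by rewrite subrr.
Qed.

(** By alternation, twice the sum of what follows a nonzero entry x is the
    difference between the last nonzero entry and x, which telescopes; again the
    sequence is taken to follow an entry -1. *)
Lemma alternating_sum s : alternating s -> \sum_(x <- s) x = 1.
Proof.
suff H x t : (x == 1) || (x == -1) -> path (fun x y : int => y == - x) x (nonzero t) ->
    (\sum_(x <- t) x) *+ 2 = last x (nonzero t) - x.
  case/and4P=> _ h l so; have := H (-1) s isT; rewrite /= in h l so *.
  case: (filter _ _) h l so => //= y t /eqP-> /eqP-> -> /(_ isT) e.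
  by lia.
elim: t x => [|z t IH] x //= hx; rewrite ?big_nil ?subrr // big_cons.
case: eqVneq => [->|z0] /=; first by rewrite add0r; apply: IH.
case/andP=> /eqP ez p; have := IH z _ p => /(_ _) e.
have {}e := e ltac:(by rewrite ez; case/orP: hx => /eqP->).
by rewrite mulrnDl e mulr2n addrACA subrr addr0 addrC; congr (_ + _).
Qed.

(** Inserting or deleting zeros does not matter, which is how alternation passes
    to the rows and columns of a shuffle of padded matrices. *)
Lemma alternating_nonzero s s' : nonzero s = nonzero s' -> alternating s = alternating s'.
Proof.
have H t : alternating t = [&& all (mem [:: 0; 1; -1]) (nonzero t), head 0 (nonzero t) == 1,
   last 0 (nonzero t) == 1 & sorted (fun x y : int => y == - x) (nonzero t)].
  rewrite /alternating; congr (_ && _); elim: t => //= x t ->.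
  by case: eqVneq => [->|].
by rewrite !H => ->.
Qed.

End Alternating.

(** * The order on row vectors *)
Section Prefix.
Variable n : nat.
Implicit Type r : 'rV[int]_n.

Definition partial_sum r (j : nat) : int := \sum_(l < n | (l < j)%N) r 0 l.

(** The smaller row is the one with the larger partial sums: for unit vectors this
    is the order of the positions of the entry 1, so that a permutation matrix is
    compared like the permutation. The partial sums up to 0, ..., n are the only
    distinct ones. *)
Definition rowle : rel 'rV[int]_n :=
  fun r r' => [forall j : 'I_n.+1, (partial_sum r' j <= partial_sum r j)%R].

Lemma partial_sum_min r j : partial_sum r j = partial_sum r (minn j n).
Proof. by apply: eq_bigl => l; rewrite ltn_min ltn_ord andbT. Qed.

Lemma rowleP r r' : reflect (forall j, (partial_sum r' j <= partial_sum r j)%R) (rowle r r').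
Proof.
apply: (iffP forallP) => // le j; rewrite partial_sum_min [X in (_ <= X)%R]partial_sum_min.
have lt : (minn j n < n.+1)%N by rewrite ltnS geq_minr.
exact: (le (Ordinal lt)).
Qed.

Lemma rowle_trans : transitive rowle.
Proof.
move=> y x z /rowleP xy /rowleP yz; apply/rowleP=> j.
exact: Order.POrderTheory.le_trans (yz j) (xy j).
Qed.

Lemma partial_sumS r (l : 'I_n) : partial_sum r l.+1 = partial_sum r l + r 0 l.
Proof.
rewrite /partial_sum (bigD1 l) //= addrC; congr (_ + _); apply: eq_bigl => i.
by rewrite ltnS ltn_neqAle andbC.
Qed.

Lemma rowle_anti : antisymmetric rowle.
Proof.
move=> x y /andP[/rowleP xy /rowleP yx]; apply/rowP=> l.
have E j : partial_sum x j = partial_sum y j.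
  by apply/eqP; rewrite Order.POrderTheory.eq_le yx xy.
by have := partial_sumS x l; rewrite !E partial_sumS => /addrI.
Qed.

End Prefix.

(** * Descents of alternating sign matrices *)
Section Hmin.
Local Open Scope nat_scope.

(** In a sorted list the elements at most j come first, and the maximum of a pair
    is at most j iff both elements are. *)
Lemma count_zip_max j (a b : seq nat) : sorted leq a -> sorted leq b ->
  count (fun x => x <= j) [seq maxn p.1 p.2 | p <- zip a b] =
  minn (count (fun x => x <= j) a) (count (fun x => x <= j) b).
Proof.
elim: a b => [|x a IH] [|y b] //= pa pb; rewrite ?minn0 ?min0n //.
rewrite geq_max IH ?(path_sorted pa) ?(path_sorted pb) //.
have big z c : path leq z c -> (z <= j) = false -> count (fun x => x <= j) c = 0.
  rewrite (path_sortedE leq_trans) => /andP[/allP al _] zj; apply/eqP.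
  rewrite -leqn0 leqNgt -has_count.
  by apply/hasPn=> w /al zw; apply: contraFN zj; apply: leq_trans.
case xj: (x <= j); case yj: (y <= j) => //=;
  rewrite ?(big _ _ pa xj) ?(big _ _ pb yj) ?addn0 ?add0n ?minn0 ?min0n //.
by rewrite !add1n minnSS.
Qed.

Lemma sorted_zip_max (a b : seq nat) : sorted leq a -> sorted leq b ->
  sorted leq [seq maxn p.1 p.2 | p <- zip a b].
Proof.
have H x y c d : path leq x c -> path leq y d ->
    path leq (maxn x y) [seq maxn p.1 p.2 | p <- zip c d].
  elim: c d x y => [|z c IH] [|w d] //= x y /andP[xz pc] /andP[yw pd].
  by rewrite IH // geq_max !leq_max xz yw orbT.
by case: a b => [|x a] [|y b] //=; apply: H.
Qed.

Lemma sorted_count_eq (s s' : seq nat) : sorted leq s -> sorted leq s' ->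
  (forall j, count (fun x => x <= j) s = count (fun x => x <= j) s') -> s = s'.
Proof.
move=> so so' cs; apply: (sorted_eq leq_trans anti_leq so so').
have cS t x : count (fun y => y <= x.+1) t = count (fun y => y <= x) t + count_mem x.+1 t.
  by elim: t => //= z t ->; rewrite leq_eqVlt ltnS; case: eqVneq => [->|_] /=; lia.
apply/allP=> -[|x] _ /=.
  have c0 t : count (fun y => y <= 0) t = count_mem 0 t by apply: eq_count => -[].
  by rewrite -!c0 cs.
by have := cs x.+1; rewrite !cS cs => /addnI->.
Qed.

End Hmin.

Lemma nth_mxrows p q (M : 'M[int]_(p, q)) (i : 'I_p) : nth 0 (mxrows M) i = row i M.
Proof. by rewrite (nth_map i) ?size_enum_ord // nth_ord_enum. Qed.

Lemma size_mxrows p q (M : 'M[int]_(p, q)) : size (mxrows M) = p.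
Proof. by rewrite size_map size_enum_ord. Qed.

Lemma asm_row n (A : asm n) i : alternating [seq A i j | j <- enum 'I_n].
Proof. by case: A => A /= /andP[/forallP]. Qed.

Lemma asm_col n (A : asm n) j : alternating [seq A i j | i <- enum 'I_n].
Proof. by case: A => A /= /andP[_ /forallP]. Qed.

Lemma partial_sum_row p q (M : 'M[int]_(p, q)) i j :
  partial_sum (row i M) j = \sum_(x <- take j [seq M i l | l <- enum 'I_q]) x.
Proof. by rewrite -sum_take; apply: eq_bigr => l _; rewrite mxE. Qed.

Lemma asm_partial_sum n (A : asm n) i j :
  (partial_sum (row i A) j == 0) || (partial_sum (row i A) j == 1).
Proof. by rewrite partial_sum_row; apply/alternating_partial_sum/asm_row. Qed.

Lemma asm_row_sum n (A : asm n) i j : (n <= j)%N -> partial_sum (row i A) j = 1.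
Proof.
move=> nj; rewrite partial_sum_row take_oversize; last by rewrite size_map size_enum_ord.
exact: (alternating_sum (asm_row A i)).
Qed.

(** Both sides are the corner sum of the first m rows and j columns, summed by
    columns on the left: the partial sum of a column is the indicator of its
    membership in the triangle. *)
Lemma count_mtriangle n (A : asm n) m j :
  (count (fun x => x <= j)%N (elems (mtriangle A m)))%:Z =
  \sum_(i < n | (i < m)%N) partial_sum (row i A) j.
Proof.
rewrite /elems count_map -sum1_count big_enum_cond (big_morph Posz PoszD (erefl _)).
rewrite big_andbC big_mkcondr [RHS](exchange_big) /=; apply: eq_bigr => l _.
rewrite (eq_bigr (fun i => A i l)) => [|i _]; last by rewrite mxE.
rewrite inE; have := alternating_partial_sum m (asm_col A l); rewrite -sum_take.
by case: eqP => [->|_]; [|case/orP=> // /eqP->].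
Qed.

Definition ord_here n (k : 'I_n.-1) : 'I_n := widen_ord (leq_pred n) k.
Definition ord_next n (k : 'I_n.-1) : 'I_n := Ordinal (ord_next_subproof k).

Lemma mem_descents_mxrows p q (M : 'M[int]_(p, q)) (e : rel 'rV[int]_q) k :
  (k \in descents 0 e p (mxrows M)) = ~~ e (row (ord_here k) M) (row (ord_next k) M).
Proof. by rewrite inE -!nth_mxrows. Qed.

(** With c the corner sums and p, q in {0, 1} the partial sums of the two rows,
    the condition c + p = min(c + 1, c + p + q) for a non-descent says q <= p. *)
Lemma asm_des_descents n (A : asm n) : asm_des A = descents 0 (@rowle n) n (mxrows A).
Proof.
apply/setP=> i; rewrite mem_descents_mxrows !inE; congr (~~ _).
set i0 := ord_here i; set i1 := ord_next i.
pose c m j := count (fun x => x <= j)%N (elems (mtriangle A m)).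
have cS (k : 'I_n) j : (c k.+1 j)%:Z = (c k j)%:Z + partial_sum (row k A) j.
  rewrite !count_mtriangle (bigD1 k) //= addrC; congr (_ + _); apply: eq_bigl => l.
  by rewrite ltnS ltn_neqAle andbC.
have so m : sorted leq (elems (mtriangle A m)).
  by apply: sub_sorted (elems_sorted _) => x y; apply: ltnW.
(* The 0 in front is the a_0 of the definition of H_min. *)
have so0 m : sorted leq (0%N :: elems (mtriangle A m)).
  by move: (so m); case: (elems _).
have cH m m' j :
    count (fun x => x <= j)%N (hmin (elems (mtriangle A m)) (elems (mtriangle A m'))) =
    minn (c m j).+1 (c m' j) by rewrite count_zip_max.
have key j : (c i.+1 j == minn (c i j).+1 (c i.+2 j)) =
    (partial_sum (row i1 A) j <= partial_sum (row i0 A) j)%R.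
  have := cS i0 j; have := cS i1 j.
  have := asm_partial_sum A i0 j; have := asm_partial_sum A i1 j.
  by rewrite /=; do 2 (case/orP=> /eqP->); lia.
apply/eqP/rowleP => [e j|le].
  by rewrite -key -cH -e.
apply: sorted_count_eq => // [|j]; first exact: sorted_zip_max.
by rewrite cH; apply/eqP; rewrite key.
Qed.

(** * Shuffles of the rows of two alternating sign matrices *)
Section Blocks.
Variables a b : nat.

Lemma enum_ord_split :
  enum 'I_(a + b) = map (lshift b) (enum 'I_a) ++ map (@rshift a b) (enum 'I_b).
Proof.
apply: (inj_map val_inj); rewrite val_enum_ord iotaD add0n -{2}[a]addn0 iotaDl.
rewrite map_cat -(map_comp val (lshift b)) -(map_comp val (@rshift a b)).
by rewrite -(val_enum_ord b) -map_comp -(val_enum_ord a).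
Qed.

Lemma partial_sum_row_mxl (r : 'rV[int]_a) j :
  partial_sum (row_mx r (0 : 'rV_b)) j = partial_sum r j.
Proof.
rewrite /partial_sum big_split_ord /=.
rewrite [X in _ + X]big1 ?addr0 => [|i _]; last by rewrite row_mxEr mxE.
by apply: eq_bigr => i _; rewrite row_mxEl.
Qed.

Lemma partial_sum_row_mxr (r : 'rV[int]_b) j :
  partial_sum (row_mx (0 : 'rV_a) r) j = partial_sum r (j - a).
Proof.
rewrite /partial_sum big_split_ord /=.
rewrite [X in X + _]big1 ?add0r => [|i _]; last by rewrite row_mxEl mxE.
by apply: eq_big => i; rewrite ?row_mxEr //= ltn_subRL.
Qed.

Lemma rowle_row_mxl (r r' : 'rV[int]_a) :
  rowle (row_mx r (0 : 'rV_b)) (row_mx r' 0) = rowle r r'.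
Proof. by apply/rowleP/rowleP => le j; have := le j; rewrite !partial_sum_row_mxl. Qed.

Lemma rowle_row_mxr (r r' : 'rV[int]_b) :
  rowle (row_mx (0 : 'rV_a) r) (row_mx 0 r') = rowle r r'.
Proof.
apply/rowleP/rowleP => le j; last by rewrite !partial_sum_row_mxr.
by have := le (j + a)%N; rewrite !partial_sum_row_mxr addnK.
Qed.

Variables (A : asm a) (B : asm b).

Let U := mxrows (row_mx A (0 : 'M_(a, b))).
Let W := mxrows (row_mx (0 : 'M_(b, a)) B).

Lemma mem_upper x : x \in U -> exists i, x = row_mx (row i A) 0.
Proof. by case/mapP=> i _ ->; exists i; rewrite row_row_mx row0. Qed.

Lemma mem_lower x : x \in W -> exists i, x = row_mx 0 (row i B).
Proof. by case/mapP=> i _ ->; exists i; rewrite row_row_mx row0. Qed.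

(** The partial sums of a row of B start at column a, where those of a row of A
    have already reached their final value 1. *)
Lemma rowle_upper_lower : {in U & W, forall x y, rowle x y && ~~ rowle y x}.
Proof.
move=> _ _ /mem_upper[i ->] /mem_lower[k ->].
have p0 (r : 'rV[int]_b) : partial_sum r 0 = 0 by apply: big_pred0.
apply/andP; split.
  apply/rowleP=> j; rewrite partial_sum_row_mxl partial_sum_row_mxr.
  have [ja|aj] := leqP j a.
    by rewrite (eqP ja) p0; case/orP: (asm_partial_sum A i j) => /eqP->.
  by rewrite (asm_row_sum A i (ltnW aj)); case/orP: (asm_partial_sum B k (j - a)) => /eqP->.
apply/negP => /rowleP/(_ a); rewrite partial_sum_row_mxl partial_sum_row_mxr subnn p0.
by rewrite asm_row_sum.
Qed.

Lemma alternating_row_mxl i :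
  alternating [seq row_mx (row i A) (0 : 'rV_b) 0 j | j <- enum 'I_(a + b)].
Proof.
rewrite -(alternating_nonzero (s := [seq A i j | j <- enum 'I_a])) ?asm_row //.
rewrite enum_ord_split map_cat filter_cat -(map_comp _ (lshift b)) -(map_comp _ (@rshift a b)).
rewrite [X in _ ++ X](_ : _ = [::]) ?cats0.
  by congr filter; apply: eq_map => j /=; rewrite row_mxEl mxE.
by elim: (enum _) => //= j l ->; rewrite row_mxEr mxE eqxx.
Qed.

Lemma alternating_row_mxr i :
  alternating [seq row_mx (0 : 'rV_a) (row i B) 0 j | j <- enum 'I_(a + b)].
Proof.
rewrite -(alternating_nonzero (s := [seq B i j | j <- enum 'I_b])) ?asm_row //.
rewrite enum_ord_split map_cat filter_cat -(map_comp _ (lshift b)) -(map_comp _ (@rshift a b)).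
rewrite [X in X ++ _](_ : _ = [::]).
  by congr filter; apply: eq_map => j /=; rewrite row_mxEr mxE.
by elim: (enum _) => //= j l ->; rewrite row_mxEl mxE eqxx.
Qed.

(** Each row and each column of the shuffle is one of A or of B with zeros
    inserted. *)
Lemma interleave_is_asm t : marks t U W ->
  exists C : asm (a + b), mxrows C = interleave t U W.
Proof.
move=> m; pose M := \matrix_(i < a + b) nth 0 (interleave t U W) i.
have sz : size (interleave t U W) = (a + b)%N.
  by rewrite size_interleave // (size_marks m) !size_mxrows.
have rM : mxrows M = interleave t U W.
  apply: (@eq_from_nth _ 0) => [|i]; rewrite size_mxrows ?sz // => lt.
  by rewrite -[i]/(val (Ordinal lt)) nth_mxrows rowK.
suff asmM : is_asm M by exists (ASM_ asmM).
apply/andP; split; apply/forallP=> i.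
  have : row i M \in interleave t U W by rewrite -rM; apply: map_f; rewrite mem_enum.
  rewrite (perm_mem (perm_interleave m)) mem_cat.
  rewrite (eq_map (g := fun j => row i M 0 j)) => [|j]; last by rewrite [RHS]mxE.
  case/orP=> [/mem_upper[k ->]|/mem_lower[k ->]].
    exact: alternating_row_mxl.
  exact: alternating_row_mxr.
have -> : [seq M k i | k <- enum 'I_(a + b)] = map (fun r : 'rV_(a + b) => r 0 i) (mxrows M).
  by rewrite /mxrows -map_comp; apply: eq_map => k /=; rewrite [RHS]mxE.
rewrite rM map_interleave /U /W /mxrows.
rewrite -(map_comp _ (fun k => row k _)) -(map_comp _ (fun k => row k _)).
have m' : marks t [seq row_mx A (0 : 'M_(a, b)) k i | k <- enum 'I_a]
                  [seq row_mx (0 : 'M_(b, a)) B k i | k <- enum 'I_b].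
  move: m; rewrite /marks !size_mxrows (size_map (fun k => row_mx A _ k i)).
  by rewrite (size_map (fun k => row_mx _ B k i)) !size_enum_ord.
rewrite (eq_map (g := fun k => row_mx A (0 : 'M_(a, b)) k i)) => [|k]; last first.
  by rewrite /= mxE.
rewrite [X in interleave _ _ X](eq_map (g := fun k => row_mx (0 : 'M_(b, a)) B k i));
  last by move=> k; rewrite /= mxE.
case: (split_ordP i) m' => j -> m'.
  rewrite -(alternating_nonzero (s := [seq A i j | i <- enum 'I_a])) ?asm_col //.
  rewrite filter_interleave_l //.
    by congr filter; apply: eq_map => k /=; rewrite row_mxEl.
  by elim: (enum _) {m m'} => //= k l ->; rewrite row_mxEl mxE eqxx.
rewrite -(alternating_nonzero (s := [seq B i j | i <- enum 'I_b])) ?asm_col //.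
rewrite filter_interleave_r //.
  by congr filter; apply: eq_map => k /=; rewrite row_mxEr.
by elim: (enum _) {m m'} => //= k l ->; rewrite row_mxEr mxE eqxx.
Qed.

Lemma mxrows_inj p q : injective (@mxrows p q).
Proof. by move=> M N e; apply/row_matrixP=> i; rewrite -!nth_mxrows e. Qed.

Lemma series_mul_asm_des m :
  \sum_(C : asm (a + b) | is_shuffle U W (mxrows C))
     series (fundamental (comp_of_set (asm_des C))) m =
  series_mul (series (fundamental (comp_of_set (asm_des A))))
             (series (fundamental (comp_of_set (asm_des B)))) m.
Proof.
have -> : asm_des A = descents 0 (@rowle (a + b)) a U.
  rewrite asm_des_descents; apply/setP=> k; rewrite !mem_descents_mxrows !row_row_mx.
  by rewrite !row0 rowle_row_mxl.
have -> : asm_des B = descents 0 (@rowle (a + b)) b W.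
  rewrite asm_des_descents; apply/setP=> k; rewrite !mem_descents_mxrows !row_row_mx.
  by rewrite !row0 rowle_row_mxr.
have := series_mul_descents 0 (@rowle_trans _) (@rowle_anti _) rowle_upper_lower m.
rewrite !size_mxrows => ->.
have := @big_is_shuffle _ (asm (a + b)) int U W (fun C => mxrows C)
  (fun C => series (fundamental (comp_of_set (asm_des C))) m)
  (fun s => series (fundamental (comp_of_set (descents 0 (@rowle (a + b)) (a + b) s))) m).
rewrite !size_mxrows; apply.
- by move=> C D /mxrows_inj/val_inj.
- exact: interleave_is_asm.
- exact: ordered_disjoint rowle_upper_lower.
- by move=> C; rewrite asm_des_descents.
Qed.

End Blocks.

(** * Permutations and permutation matrices *)
Section Perms.

Lemma nth_word n (w : 'S_n) (i : 'I_n) : nth 0%N (word w) i = (w i).+1.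
Proof. by rewrite (nth_map i) ?size_enum_ord // nth_ord_enum. Qed.

Lemma size_word n (w : 'S_n) : size (word w) = n.
Proof. by rewrite size_map size_enum_ord. Qed.

Lemma word_inj n : injective (@word n).
Proof.
move=> w w' e; apply/permP=> i; apply/val_inj/eq_add_S.
by rewrite -!nth_word e.
Qed.

Lemma perm_word n (w : 'S_n) : perm_eq (word w) (iota 1 n).
Proof.
apply: uniq_perm; rewrite ?iota_uniq //.
  by rewrite map_inj_uniq ?enum_uniq // => i j [/val_inj/perm_inj].
move=> x; rewrite mem_iota add1n ltnS; apply/mapP/andP => [[i _ ->]|[x0 xn]].
  by rewrite ltn_ord.
have xn' : (x.-1 < n)%N by rewrite prednK.
exists ((w^-1)%g (Ordinal xn')); rewrite ?mem_enum //.
by rewrite permKV /= prednK.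
Qed.

Lemma perm_of_word n s : perm_eq s (iota 1 n) -> exists w : 'S_n, word w = s.
Proof.
move=> ps; have ss : size s = n by rewrite (perm_size ps) size_iota.
have us : uniq s by rewrite (perm_uniq ps) iota_uniq.
have bnd (i : 'I_n) : (0 < nth 0 s i <= n)%N.
  have := mem_nth 0%N (_ : i < size s)%N; rewrite ss ltn_ord => /(_ isT).
  by rewrite (perm_mem ps) mem_iota add1n ltnS.
have lt (i : 'I_n) : ((nth 0 s i).-1 < n)%N by case/andP: (bnd i) => x0 xn; rewrite prednK.
have inj : injective (fun i : 'I_n => Ordinal (lt i)).
  move=> i j [/(congr1 succn)].
  rewrite !prednK; try by case/andP: (bnd i); case/andP: (bnd j).
  by move/eqP; rewrite nth_uniq ?ss // => /eqP/val_inj.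
exists (perm inj); apply: (@eq_from_nth _ 0%N) => [|i]; rewrite size_word // => ltin.
rewrite -[i]/(val (Ordinal ltin)) nth_word permE /= prednK //.
by case/andP: (bnd (Ordinal ltin)).
Qed.

Lemma perm_des_descents n (w : 'S_n) : perm_des w = descents 0%N leq n (word w).
Proof. by apply/setP=> i; rewrite !inE ltnNge. Qed.

Lemma series_mul_perm_des a b (u : 'S_a) (v : 'S_b) m :
  \sum_(w : 'S_(a + b) | is_shuffle (word u) (map (addn a) (word v)) (word w))
     series (fundamental (comp_of_set (perm_des w))) m =
  series_mul (series (fundamental (comp_of_set (perm_des u))))
             (series (fundamental (comp_of_set (perm_des v)))) m.
Proof.
set v' := map _ _; have sv : size v' = b by rewrite size_map size_word.
have uv : {in word u & v', forall x y, (x <= y) && ~~ (y <= x)}%N.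
  move=> x y; rewrite (perm_mem (perm_word u)) mem_iota add1n ltnS => /andP[_ xa].
  case/mapP=> z; rewrite (perm_mem (perm_word v)) mem_iota => /andP[z0 _] ->.
  by rewrite -ltnNge ltnW (leq_ltn_trans xa) // -[X in (X < _)%N]addn0 ltn_add2l.
have -> : perm_des v = descents 0%N leq b v'.
  rewrite perm_des_descents; apply/setP=> k; rewrite !inE.
  have lt := ord_next_subproof k.
  by rewrite !(nth_map 0%N) ?size_word // ?leq_add2l // ltnW.
have := series_mul_descents 0%N leq_trans anti_leq uv m.
rewrite sv size_word -perm_des_descents => ->.
have := @big_is_shuffle _ 'S_(a + b) int (word u) v' (@word _)
  (fun w => series (fundamental (comp_of_set (perm_des w))) m)
  (fun s => series (fundamental (comp_of_set (descents 0%N leq (a + b) s))) m).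
rewrite sv size_word; apply.
- exact: word_inj.
- move=> t mt; apply: perm_of_word; apply: (perm_trans (perm_interleave mt)).
  rewrite iotaD addnC iotaDl; apply: perm_cat; first exact: perm_word.
  by apply: perm_map; apply: perm_word.
- exact: ordered_disjoint uv.
- by move=> w; rewrite perm_des_descents.
Qed.

(** The partial sum up to j of the row of w_k is 1 when w_k <= j and 0 otherwise,
    so that [rowle] compares w_k with w_{k+1}. *)
Lemma asm_des_perm n (w : 'S_n) : asm_des (perm_asm w) = perm_des w.
Proof.
apply/setP=> k; rewrite asm_des_descents mem_descents_mxrows inE.
rewrite -[nth _ _ k.+1]/(nth 0%N (word w) (ord_next k)).
rewrite -[nth _ _ k]/(nth 0%N (word w) (ord_here k)) !nth_word ltnS ltnNge; congr (~~ _).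
have ps i j : partial_sum (row i (perm_mx w)) j = (w i < j)%N%:R.
  rewrite /partial_sum; case: ltnP => [lt|ge].
    rewrite (bigD1 (w i)) //= !mxE eqxx big1 ?addr0 // => l /andP[_ /negPf ne].
    by rewrite !mxE eq_sym ne.
  apply: big1 => l lj; rewrite !mxE; case: eqP => // e; move: lj.
  by rewrite -e ltnNge ge.
apply/rowleP/idP => [/(_ (w (ord_next k)).+1)|le j]; rewrite /= !ps.
  by rewrite ltnSn ltnS; case: leqP.
case: (ltnP (w (ord_next k)) j) => [lt|_]; last by case: (_ < _)%N.
by rewrite (leq_ltn_trans le lt).
Qed.

End Perms.

(** * Extension by linearity *)
Section Linear.

Lemma linextU (K : choiceType) (V : zmodType) (f : K -> V) k : linext f << k >> = f k.
Proof.
rewrite (linextEw f (msuppU_le : _ `<=` [fset k])%fset).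
by rewrite big_seq_fset1 mcoeffUU mulr1z.
Qed.

Lemma malg_ext (K : choiceType) (V : zmodType) (f g : {malg K} -> V) :
  zmod_morphism f -> zmod_morphism g -> (forall k, f << k >> = g << k >>) -> f =1 g.
Proof.
move=> hf hg e x.
pose F : {additive {malg K} -> V} := HB.pack f (GRing.isZmodMorphism.Build _ _ f hf).
pose G : {additive {malg K} -> V} := HB.pack g (GRing.isZmodMorphism.Build _ _ g hg).
rewrite -[f]/(F : _ -> _) -[g]/(G : _ -> _) [x]monalgE !raddf_sum; apply: eq_bigr => k _.
have -> : << x@_k *g k >> = << k >> *~ x@_k :> {malg K}.
  apply/malgP=> l; rewrite raddfMz /= !mcoeffU.
  by case: (k == l); rewrite ?mulr0n ?mul0rz // !mulr1n intz.
by rewrite !raddfMz /= e.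
Qed.

Lemma linext_sum (K : choiceType) (V : zmodType) (F : K -> V) (I : finType) (P : pred I)
    (G : I -> {malg K}) :
  linext F (\sum_(i | P i) G i) = \sum_(i | P i) linext F (G i).
Proof. exact: raddf_sum. Qed.

Lemma algebra_morphism_basis (K : choiceType) (F : K -> QSym)
    (mul : K -> K -> {malg K}) (one : K) :
    series (F one) =1 series_one ->
    (forall k k' m, series (linext F (mul k k')) m =
                    series_mul (series (F k)) (series (F k')) m) ->
  QSym_algebra_morphism (bilinext mul) << one >> (linext F).
Proof.
move=> F1 FM; split=> [m|x y m]; first by rewrite /= linextU F1.
have addmul G : zmod_morphism (fun x => series_mul (series (linext F x)) G m).
  move=> x1 x2; rewrite /series_mul -sumrB; apply: eq_bigr => d _.
  by rewrite !seriesE !raddfB /= mulrBl.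
have addmul' G : zmod_morphism (fun y => series_mul G (series (linext F y)) m).
  move=> x1 x2; rewrite /series_mul -sumrB; apply: eq_bigr => d _.
  by rewrite !seriesE !raddfB /= mulrBr.
move: x; apply: malg_ext => [x1 x2||k]; [|exact: addmul|].
  by rewrite !seriesE /bilinext !raddfB.
rewrite /= [bilinext mul << k >> y]linextU [linext F << k >>]linextU; move: y.
apply: malg_ext => [y1 y2||k']; [|exact: addmul'|].
  by rewrite !seriesE !raddfB.
by rewrite /= [linext _ << k' >>]linextU [linext F << k' >>]linextU FM.
Qed.

Lemma series_empty (D : {set 'I_0.-1}) : series (fundamental (comp_of_set D)) =1 series_one.
Proof.
move=> m; rewrite seriesE mcoeff_fundamental refines_comp_of_set /series_one -size_letters.
rewrite [X in _ && X](_ : _ = true) ?andbT; last by apply/forallP => -[].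
suff -> : (size (letters m) == 0)%N = (m == mone) by [].
apply/eqP/eqP => [/size0nil e|->].
  by apply/eqP/cmP => i; rewrite -count_letters e cm1.
by rewrite (@letters_unique _ [::]) // => i; rewrite cm1.
Qed.

Lemma FQSym_morphism : QSym_algebra_morphism FQSym_mul FQSym_one FQSym_to_QSym.
Proof.
apply: algebra_morphism_basis => [|[a u] [b v] m]; first exact: series_empty.
rewrite seriesE /= linext_sum raddf_sum /= -series_mul_perm_des.
by apply: eq_bigr => w _; rewrite linextU seriesE.
Qed.

Lemma ASM_morphism : QSym_algebra_morphism ASM_mul ASM_one ASM_to_QSym.
Proof.
apply: algebra_morphism_basis => [|[a A] [b B] m]; first exact: series_empty.
rewrite seriesE /= linext_sum raddf_sum /= -series_mul_asm_des.
by apply: eq_bigr => w _; rewrite linextU seriesE.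
Qed.

Lemma ASM_to_QSym_extends x : ASM_to_QSym (FQSym_to_ASM x) = FQSym_to_QSym x.
Proof.
move: x; apply: malg_ext => [x y|x y|[n w]].
- by rewrite !raddfB.
- by rewrite !raddfB.
by rewrite /= !linextU /= asm_des_perm.
Qed.

End Linear.

(** * Failure of comultiplicativity *)
Section NotCoalgebra.
Local Open Scope nat_scope.

Fact ones_gt0 n : all (leq 1) (nseq n 1).
Proof. by rewrite all_nseq orbT. Qed.
Definition ones n : composition := Composition (ones_gt0 n).

Lemma sums_ones n : sums (ones n) = iota 1 n.
Proof.
rewrite /=; elim: n => //= n IH; rewrite sums_cons IH; congr (_ :: _).
by rewrite -iotaDl.
Qed.

Lemma sumn_ones n : sumn (ones n) = n.
Proof. by rewrite /= sumn_nseq mul1n. Qed.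

(** So M_{1...1} occurs in every fundamental function of its degree, whatever the
    descent set. *)
Lemma refines_ones n (a : composition) : refines (ones n) a = (sumn a == n).
Proof.
rewrite refinesE sumn_ones eq_sym; case: eqP => //= <-; rewrite sums_ones.
apply/allP=> x xa; rewrite inE mem_iota add1n ltnS sums_le // andbT.
have := path_sums (parts_gt0 a); rewrite (path_sortedE ltn_trans) => /andP[/allP pos _].
exact: pos.
Qed.

Lemma mcoeff_QSym_coprod_ones p q (x : QSym) :
  ((QSym_coprod x)@_(ones p, ones q) = x@_(ones (p + q)))%R.
Proof.
move: x; apply: malg_ext => [x y|x y|a]; rewrite ?raddfB // /QSym_coprod ?raddfB //.
rewrite linextU raddf_sum /= mcoeffU.
have [->|ne] := eqVneq a (ones (p + q)).
  have lt : p < (size (ones (p + q))).+1 by rewrite size_nseq ltnS leq_addr.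
  rewrite (bigD1 (Ordinal lt)) //= mcoeffU big1 => [|i ip].
    rewrite addr0 xpair_eqE -!val_eqE /= take_nseq ?leq_addr // drop_nseq addKn !eqxx //.
  rewrite mcoeffU xpair_eqE -!val_eqE /=; case: eqP => // e; case/negP: ip.
  rewrite -val_eqE /=; have := congr1 size e; rewrite size_takel; last first.
    by rewrite -ltnS ltn_ord.
  by move->; rewrite size_nseq.
apply: big1 => i _; rewrite mcoeffU xpair_eqE -!val_eqE /=.
case: eqP => // e1; case: eqP => // e2; case/eqP: ne.
by apply/val_inj; rewrite /= -(cat_take_drop i a) e1 e2 -nseqD.
Qed.

Lemma mcoeff_tensor (K K' : choiceType) (x : {malg K}) (y : {malg K'}) k k' :
  ((tensor x y)@_(k, k') = x@_k * y@_k')%R.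
Proof.
move: x; apply: malg_ext => [x1 x2|x1 x2|l]; first by rewrite /tensor /bilinext !raddfB.
  by rewrite raddfB /= mulrBl.
rewrite /tensor /bilinext linextU; move: y; apply: malg_ext => [x1 x2|x1 x2|l'].
- by rewrite !raddfB.
- by rewrite raddfB /= mulrBr.
by rewrite linextU !mcoeffU xpair_eqE; case: (l == k); case: (l' == k').
Qed.

(** The entries of the alternating sign matrix with rows 010, 1-11, 010. *)
Definition cross_entry (i j : nat) : int :=
  if (i == 1) && (j == 1) then (-1)%R else (odd (i + j))%:R%R.
Definition cross : 'M[int]_3 := \matrix_(i, j) cross_entry i j.

Lemma cross_is_asm : is_asm cross.
Proof.
have E (f : nat -> int) : [seq f (val j) | j <- enum 'I_3] = [:: f 0; f 1; f 2].
  by rewrite (map_comp f val) val_enum_ord.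
apply/andP; split; apply/forallP => i.
  rewrite (eq_map (g := fun j : 'I_3 => cross_entry i (val j))) => [|j]; last by rewrite mxE.
  by rewrite E; case: i => [[|[|[|i]]]].
rewrite (eq_map (g := fun j : 'I_3 => cross_entry (val j) i)) => [|j]; last by rewrite mxE.
by rewrite (E (cross_entry^~ i)); case: i => [[|[|[|i]]]].
Qed.

(** The second row has no zero entry, so the last two rows keep all three columns. *)
Lemma cross_no_cut (i : 'I_4) (C : asm (3 - i)) : val i = 1 ->
  ~~ del_zero_cols (last_rows i cross) C.
Proof.
move=> i1; apply/negP => /eqP/(congr1 size); rewrite size_map size_enum_ord.
rewrite (_ : filter _ _ = mxcols (last_rows i cross)); last first.
  apply/all_filterP/allP=> _ /mapP[j _ ->]; apply/negP => /eqP/matrixP.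
  have lt : 0 < 3 - i by rewrite i1.
  move/(_ (Ordinal lt) 0%R); rewrite !mxE /= addn0 i1.
  by case: j => [[|[|[|j]]]].
by rewrite size_map size_enum_ord i1.
Qed.

(** The two sides differ in the coefficient of M_1 (x) M_{11}. On the side of the
    coproduct of matrices only a cut after the first row has the right degrees. *)
Lemma ASM_not_coalgebra :
  ~ coalgebra_morphism ASM_coprod ASM_counit QSym_coprod QSym_counit ASM_to_QSym.
Proof.
case=> /(_ << gasm_of (ASM_ cross_is_asm) >>%R) + _.
move/(congr1 (mcoeff (ones 1, ones 2))).
rewrite mcoeff_QSym_coprod_ones /ASM_coprod linextU /= linextU mcoeff_fundamental refines_ones.
rewrite sumn_comp_of_set eqxx /tensor_map.
rewrite linext_sum raddf_sum big1 // => i _.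
rewrite linext_sum raddf_sum big1 // => B _.
rewrite linext_sum raddf_sum big1 // => C dC.
rewrite /= linextU mcoeff_tensor /= !linextU !mcoeff_fundamental !refines_ones !sumn_comp_of_set.
case: eqP => [i1|]; last by rewrite mul0r.
by have := cross_no_cut C i1; rewrite dC.
Qed.
End NotCoalgebra.

Theorem theorem1p3 :
  QSym_algebra_morphism FQSym_mul FQSym_one FQSym_to_QSym /\
  QSym_algebra_morphism ASM_mul ASM_one ASM_to_QSym /\
  (forall x : FQSym, ASM_to_QSym (FQSym_to_ASM x) = FQSym_to_QSym x) /\
  ~ coalgebra_morphism ASM_coprod ASM_counit QSym_coprod QSym_counit ASM_to_QSym.
Proof.
exact: (conj FQSym_morphism (conj ASM_morphism (conj ASM_to_QSym_extends ASM_not_coalgebra))).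
Qed.
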